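(* Let $\Gamma$ be a metric graph and $K$ a finite group acting isometrically on $\Gamma$. Then there exist an integer $n\ge 1$ and rational functions $f_1,\dots,f_n$ on $\Gamma$ such that the rational map $\phi=(f_1:\cdots:f_n):\Gamma\to \boldsymbol{TP}^{n-1}$ induces a $K$-Galois covering $\Gamma\to \mathrm{Im}(\phi)$ with some edge-multiplicities on $\Gamma$ and $\mathrm{Im}(\phi)$, where $\mathrm{Im}(\phi)$ is regarded as a metric graph via lattice length.
   Context: Metric graph: the underlying ($\infty$-)metric space of an edge-weighted graph $(G,l)$, where $G$ is a finite connected nonempty multigraph (loops allowed) and $l:E(G)\to\mathbb{R}_{>0}\cup\{\infty\}$ may take the value $\infty$ only on leaf edges (edges adjacent to a vertex of valence one). Each edge $e$ is identified with $[0,l(e)]$; if $l(e)=\infty$ the leaf end of $e$ is identified with $\infty$ and is called a point at infinity. $(G,l)$ is called a model of the metric graph, and a loopless model if $G$ has no loops. A half-edge of a point $x$ is a connected component of $U\setminus\{x\}$ for a sufficiently small connected neighborhood $U$ of $x$. Rational function on $\Gamma$: the constant function $-\infty$, or a piecewise linear function with integer slopes and finitely many pieces, taking values $\pm\infty$ only at points at infinity. Tropical projective space: $\boldsymbol{T}=\mathbb{R}\cup\{-\infty\}$, and $\boldsymbol{TP}^{n-1}=(\boldsymbol{T}^{n}\setminus\{(-\infty,\dots,-\infty)\})/\sim$, where $\boldsymbol{x}\sim\boldsymbol{y}$ iff $\boldsymbol{x}=\boldsymbol{y}+(\lambda,\dots,\lambda)$ for some $\lambda\in\mathbb{R}$.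 The rational map given by $f_1,\dots,f_n$ is $x\mapsto(f_1(x):\cdots:f_n(x))$ (extended continuously at points at infinity). Lattice length: if $u\ne v$ have real coordinates and, for an index $i$, $(u_j-u_i)-(v_j-v_i)=\lambda w_j$ for all $j$, with $\lambda>0$ and $w$ an integer vector whose entries have greatest common divisor $1$, then the distance between $u$ and $v$ is $\lambda$ (independent of $i$); it is $\infty$ for segments reaching coordinates $-\infty$. $\mathrm{Im}(\phi)$ is regarded as a metric graph by giving the image of each segment on which all $f_i$ are linear its lattice length. Morphism: a continuous map $\varphi:\Gamma\to\Gamma'$ of metric graphs for which there are models $(G,l)$, $(G',l')$ with $\varphi(V(G))\subset V(G')$, such that the inverse image of the relative interior of each edge of $G'$ is the union of relative interiors of finitely many edges of $G$, and $\varphi$ restricted to each edge $e$ of $G$ is a dilation by an integer factor $\deg_e(\varphi)\ge 0$. It is finite if all $\deg_e(\varphi)>0$. For a half-edge $h$ contained in an edge $e$ put $\deg_h(\varphi)=\deg_e(\varphi)$. Edge-multiplicities: take the models loopless and let $m:E(G)\to\mathbb{Z}_{>0}$, $m':E(G')\to\mathbb{Z}_{>0}$ be functions (set $m'(\varphi(e))=0$ if $\varphi(e)$ is a vertex). If $\Gamma'$ is not a singleton, $\varphi$ is harmonic at $x\in\Gamma$ (with respect to $m,m'$) if $m(e_1)$ divides $m'(\varphi(e_1))$ for each edge $e_1$ of $G$ adjacent to $x$ and the number $\deg_x^{m,m'}(\varphi)=\sum_{h}\frac{m'(\varphi(e))}{m(e)}\deg_h(\varphi)$ is independent of the half-edge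 $h'$ emanating from $\varphi(x)$, where $h$ runs over the half-edges of $x$ mapped to $h'$ and $e$ is the edge of $G$ containing $h$. It is harmonic if it is harmonic at all points; its degree is $\deg^{m,m'}(\varphi)=\sum_{x\in\varphi^{-1}(x')}\deg_x^{m,m'}(\varphi)$, which is independent of $x'\in\Gamma'$. If only $\Gamma'$ is a singleton, $\varphi$ is harmonic of degree $0$; if both are singletons, $\varphi$ is regarded as harmonic of any degree. $K$-Galois covering with edge-multiplicities $m,m'$: $\varphi$ is a finite harmonic morphism with respect to $m,m'$, $\deg^{m,m'}(\varphi)=|K|$, the action of $K$ on $\Gamma$ induces a transitive action on every fibre of $\varphi$, and $K$ preserves the edge-multiplicities.
   Formalization: The isometric action of K is also required to be continuous (by homeomorphisms) at points at infinity; otherwise the claim fails, e.g. for Z/2 fixing all finite points of [-∞,+∞] and swapping its two ends. *)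

(* Defs.v *)
From HB Require Import structures.
From mathcomp Require Import all_boot all_order all_algebra all_fingroup.
From mathcomp Require Import all_classical all_reals all_analysis.
Set Implicit Arguments.
Unset Strict Implicit.
Unset Printing Implicit Defensive.
Import Order.TTheory GRing.Theory Num.Theory.
Import numFieldNormedType.Exports.

Local Open Scope classical_set_scope.
Local Open Scope ring_scope.

(* Edge [e] is the segment [[0, len e]]; [ends e false] is its end at
   parameter [0] and [ends e true] its end at parameter [len e].  Loops and
   multiple edges are allowed, and a loop contributes 2 to the valence.  An
   edge of infinite length is oriented so that its leaf end is at [+oo]. *)
Record wgraph (R : realType) := WGraph {
  vertex : finType;
  edge : finType;
  ends : edge -> bool -> vertex;
  len : edge -> \bar R;
  valence := fun v : vertex => #|[pred h : edge * bool | ends h.1 h.2 == v]|;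
  adjacent := fun u v : vertex =>
    [exists e : edge, exists b : bool, (ends e b == u) && (ends e (~~ b) == v)];
  vertex_nonempty : (0 < #|vertex|)%N;
  wgraph_connected : forall u v : vertex, connect adjacent u v;
  len_gt0 : forall e : edge, (0 < len e)%E;
  len_infty : forall e : edge, len e = +oo%E -> valence (ends e true) = 1%N }.

Definition loopless (R : realType) (G : wgraph R) : Prop :=
  forall e : edge G, ends e false <> ends e true.

(* [chain step x y a]: [x] and [y] are joined by finitely many successive
   steps of total length [a]. *)
Inductive chain (R : realType) (X : Type) (step : X -> X -> \bar R -> Prop) :
    X -> X -> \bar R -> Prop :=
| chain_nil x : chain step x x 0%E
| chain_cons x y z a b :
    step x y a -> chain step y z b -> chain step x z (a + b)%E.

Definition path_dist (R : realType) (X : Type) (step : X -> X -> \bar R -> Prop)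
    (x y : X) : \bar R :=
  ereal_inf [set a | chain step x y a].

(* The case split is needed because [+oo - +oo] is not [0] in [\bar R]. *)
Definition seg_length (R : realType) (s t : \bar R) : \bar R :=
  if s == t then 0%E else `|s - t|%E.

Definition edge_step (R : realType) (G : wgraph R) (X : Type)
    (ept : edge G -> \bar R -> X) (x y : X) (a : \bar R) : Prop :=
  exists (e : edge G) (s t : \bar R),
    [/\ s \in `[0%E, len e], t \in `[0%E, len e],
        x = ept e s, y = ept e t & a = seg_length s t].

(* A model of the infinity-metric space [(X, d)]: an edge-weighted graph
   whose segments, glued along the vertices, give exactly [X], its topology
   and its path metric.  The topology is not determined by [d] (a point at
   infinity is at distance [+oo] from all other points), hence the separate
   [open_model] field, which says that [X] has the quotient topology of the
   segments.  [ept e] is only meaningful on [[0, len e]]. *)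
Record model (R : realType) (X : topologicalType) (d : X -> X -> \bar R) :=
  Model {
  graph :> wgraph R;
  vpt : vertex graph -> X;
  ept : edge graph -> \bar R -> X;
  ept0 : forall e, ept e 0%E = vpt (ends e false);
  ept_len : forall e, ept e (len e) = vpt (ends e true);
  vpt_inj : injective vpt;
  ept_inj : forall e e' s s', s \in `]0%E, len e[ -> s' \in `]0%E, len e'[ ->
    ept e s = ept e' s' -> e = e' /\ s = s';
  ept_vpt : forall e s v, s \in `]0%E, len e[ -> ept e s <> vpt v;
  model_cover : forall x, (exists v, x = vpt v) \/
    (exists e s, (s \in `]0%E, len e[) /\ x = ept e s);
  open_model : forall U : set X, open U <->
    forall e, open (ept e @^-1` U : set (subspace `[0%E, len e]));
  dist_model : forall x y, d x y = path_dist (edge_step ept) x y }.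

Definition edge_interior (R : realType) (X : topologicalType)
    (d : X -> X -> \bar R) (M : model d) (e : edge M) : set X :=
  ept e @` `]0%E, len e[.

Definition metric_graph (R : realType) (X : topologicalType)
    (d : X -> X -> \bar R) : Prop := inhabited (model d).

Definition point_at_infinity (R : realType) (X : topologicalType)
    (d : X -> X -> \bar R) (x : X) : Prop :=
  exists (M : model d) (e : edge M), len e = +oo%E /\ x = ept e +oo%E.

(* Since [0 * +oo = 0] in [\bar R], the formula at [s = +oo] is the continuous
   extension of the affine function. *)
Definition linear_on_edge (R : realType) (X : topologicalType)
    (d : X -> X -> \bar R) (M : model d) (e : edge M) (f : X -> \bar R) : Prop :=
  exists (a : int) (b : R), forall s, s \in `[0%E, len e] ->
    f (ept e s) = ((a%:~R : R)%:E * s + b%:E)%E.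

Definition rational_function (R : realType) (X : topologicalType)
    (d : X -> X -> \bar R) (f : X -> \bar R) : Prop :=
  (forall x, f x = -oo%E) \/
  exists M : model d, forall e : edge M, linear_on_edge e f.

Section TropicalProjectiveSpace.
Variables (R : realType) (n : nat).

Definition trop_vectors : set (prod_topology (fun _ : 'I_n => \bar R)) :=
  [set t | (forall i, t i <> +oo%E) /\ exists i, t i <> -oo%E].

Definition trop_equiv (t u : trop_vectors) : bool :=
  `[< exists lam : R, forall i, set_val t i = (set_val u i + lam%:E)%E >].

Lemma trop_equiv_refl : reflexive trop_equiv.
Proof. by move=> t; apply/asboolP; exists 0 => i; rewrite adde0. Qed.

Lemma trop_equiv_sym : symmetric trop_equiv.
Proof.
suff H t u : trop_equiv t u -> trop_equiv u t by move=> t u; apply/idP/idP; exact: H.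
move=> /asboolP[lam tu]; apply/asboolP; exists (- lam) => i.
by rewrite tu -addeA -EFinD subrr adde0.
Qed.

Lemma trop_equiv_trans : transitive trop_equiv.
Proof.
move=> u t v /asboolP[a tu] /asboolP[b uv]; apply/asboolP; exists (b + a) => i.
by rewrite tu uv -addeA -EFinD.
Qed.

Canonical trop_equiv_rel :=
  EquivRel trop_equiv trop_equiv_refl trop_equiv_sym trop_equiv_trans.

(* [TP n] has dimension [n - 1]; it is empty for [n = 0]. *)
Definition TP : topologicalType :=
  quotient_topology {eq_quot trop_equiv_rel}%qT.

(* [t] is a vector of homogeneous coordinates of [u]. *)
Definition trop_coords (u : TP) (t : 'I_n -> \bar R) : Prop :=
  exists t' : trop_vectors, set_val t' = t /\ u = (\pi_(TP) t')%qT.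

Definition lattice_length (u v : TP) (a : \bar R) : Prop :=
  [\/ u = v /\ a = 0%E,
      exists (x y : 'I_n -> R) (i : 'I_n) (lam : R) (w : 'I_n -> int),
        [/\ u <> v,
            trop_coords u (fun j => (x j)%:E) /\
            trop_coords v (fun j => (y j)%:E),
            0 < lam /\ \big[gcdn/0%N]_(j < n) `|w j|%N = 1%N,
            forall j, (x j - x i) - (y j - y i) = lam * (w j)%:~R &
            a = lam%:E]
    | [/\ u <> v,
          (exists i, exists2 t, trop_coords u t & t i = -oo%E) \/
          (exists i, exists2 t, trop_coords v t & t i = -oo%E) &
          a = +oo%E]].

End TropicalProjectiveSpace.

(* Continuity determines [phi] at the points at infinity. *)
Definition rational_map (R : realType) (X : topologicalType)
    (d : X -> X -> \bar R) (n : nat) (f : 'I_n -> X -> \bar R)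
    (phi : X -> TP R n) : Prop :=
  continuous phi /\
  forall x, ~ point_at_infinity d x -> trop_coords (phi x) (f^~ x).

Definition to_image (X Y : Type) (phi : X -> Y) (x : X) : range phi :=
  exist _ (phi x) (mem_set (imageT phi x)).

(* Path metric on the image for which the image of every segment on which all
   the [f i] are linear has its lattice length. *)
Definition image_step (R : realType) (X : topologicalType)
    (d : X -> X -> \bar R) (n : nat) (f : 'I_n -> X -> \bar R)
    (phi : X -> TP R n) (u v : range phi) (a : \bar R) : Prop :=
  exists (M : model d) (e : edge M) (s t : \bar R),
    [/\ forall i, linear_on_edge e (f i),
        s \in `[0%E, len e], t \in `[0%E, len e],
        u = to_image phi (ept e s) /\ v = to_image phi (ept e t) &
        lattice_length (set_val u) (set_val v) a].

Arguments image_step {R X} d {n} f phi.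

Definition image_dist (R : realType) (X : topologicalType)
    (d : X -> X -> \bar R) (n : nat) (f : 'I_n -> X -> \bar R)
    (phi : X -> TP R n) : range phi -> range phi -> \bar R :=
  path_dist (image_step d f phi).
Arguments image_dist {R X} d {n} f phi.

(* [edge_img e = Some e'] when [e] is mapped onto [e'], in the coordinates of
   the two edges by [s |-> edge_slope e * s + c]; [edge_img e = None] when [e]
   is contracted to a vertex. *)
Record mg_morphism (R : realType) (X Y : topologicalType)
    (dX : X -> X -> \bar R) (dY : Y -> Y -> \bar R)
    (M : model dX) (M' : model dY) (phi : X -> Y) := Morphism {
  edge_img : edge M -> option (edge M');
  edge_slope : edge M -> int;
  morphism_continuous : continuous phi;
  morphism_vertex : forall v : vertex M, exists v' : vertex M', phi (vpt v) = vpt v';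
  morphism_preimage : forall e' : edge M', exists A : set (edge M),
    phi @^-1` edge_interior e' = \bigcup_(e in A) edge_interior e;
  morphism_edge : forall e : edge M,
    match edge_img e with
    | None => edge_slope e = 0 /\
        exists v' : vertex M', forall s, s \in `[0%E, len e] -> phi (ept e s) = vpt v'
    | Some e' => edge_slope e <> 0 /\
        exists c : R, forall s, s \in `[0%E, len e] ->
          ((edge_slope e)%:~R%:E * s + c%:E)%E \in `[0%E, len e'] /\
          phi (ept e s) = ept e' ((edge_slope e)%:~R%:E * s + c%:E)%E
    end }.

(* The half-edges of [x] are encoded as pairs [(e, b)]: the germ at [x] of the
   edge [e], in the direction of increasing parameter if [b] is [true] and of
   decreasing parameter otherwise. *)
Definition half_edge (R : realType) (X : topologicalType)
    (d : X -> X -> \bar R) (M : model d) (x : X) (h : edge M * bool) : bool :=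
  `[< exists s, (if h.2 then s \in `[0%E, len h.1[ else s \in `]0%E, len h.1])
        /\ x = ept h.1 s >].

Section Harmonic.
Variables (R : realType) (X Y : topologicalType).
Variables (dX : X -> X -> \bar R) (dY : Y -> Y -> \bar R).
Variables (M : model dX) (M' : model dY) (phi : X -> Y).
Variable F : mg_morphism M M' phi.

Definition edge_deg (e : edge M) : nat := `|edge_slope F e|%N.

Definition finite_morphism : Prop := forall e, (0 < edge_deg e)%N.

Definition half_edge_img (h : edge M * bool) : option (edge M' * bool) :=
  omap (fun e' => (e', h.2 (+) (edge_slope F h.1 < 0))) (edge_img F h.1).

Variables (m : edge M -> nat) (m' : edge M' -> nat).

Definition mult_img (e : edge M) : nat := oapp m' 0%N (edge_img F e).

Definition half_edge_degree (x : X) (h' : edge M' * bool) : nat :=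
  (\sum_(h : edge M * bool | half_edge x h && (half_edge_img h == Some h'))
     mult_img h.1 %/ m h.1 * edge_deg h.1)%N.

Definition local_degree (x : X) (k : nat) : Prop :=
  forall h', half_edge (phi x) h' -> half_edge_degree x h' = k.

Definition is_singleton (T : Type) : Prop := exists x : T, forall y, y = x.

Definition harmonic_of_degree (N : nat) : Prop :=
  if `[< is_singleton Y >] then is_singleton X \/ N = 0%N
  else (forall e, (m e %| mult_img e)%N) /\
    exists2 deg : X -> nat, (forall x, local_degree x (deg x)) &
      forall y, (\sum_(x \in phi @^-1` [set y]) deg x)%R = N.

End Harmonic.

(* The underlying map of an isometric action consists of homeomorphisms: the
   [d]-preserving permutations that ignore the topology could permute the
   points at infinity arbitrarily. *)
Definition isometric_action (R : realType) (X : topologicalType)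
    (d : X -> X -> \bar R) (K : finGroupType) (to : {action K &-> X}) : Prop :=
  forall k, continuous (to^~ k) /\ forall x y, d (to x k) (to y k) = d x y.

Definition galois_covering (R : realType) (X Y : topologicalType)
    (dX : X -> X -> \bar R) (dY : Y -> Y -> \bar R)
    (K : finGroupType) (to : {action K &-> X})
    (M : model dX) (M' : model dY) (phi : X -> Y) (F : mg_morphism M M' phi)
    (m : edge M -> nat) (m' : edge M' -> nat) : Prop :=
  [/\ [/\ loopless M, loopless M', forall e, (0 < m e)%N & forall e', (0 < m' e')%N],
      finite_morphism F /\ harmonic_of_degree F m m' #|K|,
      forall k x, phi (to x k) = phi x,
      forall x y, phi x = phi y -> exists k, to x k = y
    & forall k e1 e2 x, edge_interior e1 x -> edge_interior e2 (to x k) ->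
        m e1 = m e2].

(* Main.v *)
(** Refine a model of the metric graph until its vertex set is [K]-invariant and contains the
    midpoints of the edges of a coarser invariant model.  Then [K] permutes the edges, and minus
    the distance to the coarse vertices is an invariant function with slope 1 or -1 on every
    edge: no edge is flipped, and every lattice length is the ordinary length.  Together with the
    constant [0] and the sums over [K] of small bumps supported near one vertex or on one edge,
    it separates the orbits.  Hence the image of the resulting map is the quotient graph [X / K],
    each edge being mapped isometrically; giving multiplicity 1 to the edges of [X] and the order
    of the stabiliser to the edges of the image, the orbit-stabiliser formula makes the map
    harmonic of degree [#|K|]. *)

Require Import Defs.
From HB Require Import structures.
From mathcomp Require Import all_boot all_order all_algebra all_fingroup.
From mathcomp Require Import all_classical all_reals all_analysis.
From mathcomp Require Import ring lra.
Set Implicit Arguments.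
Unset Strict Implicit.
Unset Printing Implicit Defensive.
Import Order.TTheory GRing.Theory Num.Theory.
Import numFieldNormedType.Exports.

Local Open Scope classical_set_scope.
Local Open Scope ring_scope.

(** * Path metrics and functions on a model *)

(** Two difficulties shape the proof. The action is only isometric and continuous, so nothing says
    at the outset that [K] respects a model. That edges are permuted is read off from [d]:
    1-Lipschitz functions bound an infimum over chains from below, and the distance to an invariant
    vertex set is preserved, which locates a point on its edge up to reflection. Points at infinity,
    on the other hand, are invisible to [d]: continuity must control these ends, the distance enters
    with a minus sign because tropical coordinates admit -oo but not +oo, and the bumps have to be
    constant far out on an infinite edge.

    The constant coordinate removes the freedom of shifting homogeneous coordinates, and a single
    coordinate of slope 1 or -1 beside it makes every slope vector primitive. The image has a
    topology and a metric of its own, defined without reference to the quotient: compactness of [X]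
    identifies the topology, and the metric needs two estimates, since its steps may be taken in any
    model in which the functions are linear on the edge used. *)

Section PathDist.
Context {R : realType}.

Definition nonneg_step (X : Type) (step : X -> X -> \bar R -> Prop) :=
  forall x y a, step x y a -> (0 <= a)%E.

Lemma seg_length_ge0 (s t : \bar R) : (0 <= seg_length s t)%E.
Proof. by rewrite /seg_length; case: eqP. Qed.

Lemma seg_lengthE (s t : R) : seg_length s%:E t%:E = `|s - t|%:E.
Proof.
rewrite /seg_length; case: eqP => [[->]|_]; first by rewrite subrr normr0.
by rewrite -EFinB abse_EFin.
Qed.

Lemma seg_length_eq (s : \bar R) : seg_length s s = 0%E.
Proof. by rewrite /seg_length eqxx. Qed.

Lemma seg_length_pinftyl (t : \bar R) : t != +oo%E -> seg_length +oo%E t = +oo%E.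
Proof. by rewrite /seg_length eq_sym => /negbTE ->; case: t. Qed.

Lemma seg_length_pinftyr (t : \bar R) : t != +oo%E -> seg_length t +oo%E = +oo%E.
Proof. by rewrite /seg_length => /negbTE ->; case: t. Qed.

Section OneStep.
Context {X : Type} {step : X -> X -> \bar R -> Prop}.
Hypothesis step0 : nonneg_step step.

Lemma chain_cat x y z a b :
  chain step x y a -> chain step y z b -> chain step x z (a + b)%E.
Proof.
move=> c1 c2; elim: c1 b c2 => {x y a} [x|x y w a a' s1 _ IH] b c2.
  by rewrite add0e.
by rewrite -addeA; apply: chain_cons s1 _; exact: IH.
Qed.

Lemma chain_ge0 x y a : chain step x y a -> (0 <= a)%E.
Proof. by elim=> // {}x {}y z {}a b /step0 a0 _ b0; exact: adde_ge0. Qed.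

Lemma path_dist_ge0 x y : (0 <= path_dist step x y)%E.
Proof. by apply/ereal_infP => a /chain_ge0. Qed.

Lemma path_distxx x : path_dist step x x = 0%E.
Proof.
apply/eqP; rewrite eq_le path_dist_ge0 andbT.
by apply: ereal_inf_lbound; exact: chain_nil.
Qed.

Lemma path_dist_step x y a : step x y a -> (path_dist step x y <= a)%E.
Proof.
move=> s; apply: ereal_inf_lbound; rewrite /= -(adde0 a).
by apply: chain_cons s _; exact: chain_nil.
Qed.

Lemma path_dist_triangle x y z :
  (path_dist step x z <= path_dist step x y + path_dist step y z)%E.
Proof.
have := path_dist_ge0 x y; have := path_dist_ge0 y z.
case Eb : (path_dist step y z) => [b| |] // b0;
  case Ea : (path_dist step x y) => [a| |] // a0; rewrite ?leey //.
apply/lee_addgt0Pr => e e0.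
have e2 : 0 < e / 2 by rewrite divr_gt0.
have : (path_dist step x y < (a + e / 2)%:E)%E by rewrite Ea lte_fin ltrDl.
have : (path_dist step y z < (b + e / 2)%:E)%E by rewrite Eb lte_fin ltrDl.
move=> /ereal_inf_lt[b' /= cb lb] /ereal_inf_lt[a' /= ca la].
apply: le_trans (ereal_inf_lbound (chain_cat ca cb)) _.
apply: le_trans (leeD (ltW la) (ltW lb)) _.
by rewrite -!EFinD lee_fin; lra.
Qed.

End OneStep.

(** The criterion behind every comparison of path metrics below: a bound on single steps adds up
    along chains by the triangle inequality. *)
Lemma path_dist_le (X Y : Type) (step1 : X -> X -> \bar R -> Prop)
    (step2 : Y -> Y -> \bar R -> Prop) (h : X -> Y) :
  nonneg_step step2 ->
  (forall x y a, step1 x y a -> (path_dist step2 (h x) (h y) <= a)%E) ->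
  forall x y, (path_dist step2 (h x) (h y) <= path_dist step1 x y)%E.
Proof.
move=> p2 h12 x y; apply/ereal_infP => a; elim=> {x y a} [x|x y z a b s _ IH].
  by rewrite path_distxx.
apply: le_trans (path_dist_triangle p2 _ (h y) _) _.
by apply: leeD => //; exact: h12.
Qed.

End PathDist.

Section ModelBasics.
Context {R : realType} {X : topologicalType} {d : X -> X -> \bar R}.
Implicit Types M : model d.

Lemma edge_step_ge0 M : nonneg_step (edge_step (@ept _ _ _ M)).
Proof. by move=> x y a [e [s [t [_ _ _ _ ->]]]]; exact: seg_length_ge0. Qed.

Lemma dist_ept M (e : edge M) s t : s \in `[0%E, len e] -> t \in `[0%E, len e] ->
  (d (ept e s) (ept e t) <= seg_length s t)%E.
Proof.
by move=> hs ht; rewrite (dist_model M); apply: path_dist_step; exists e, s, t.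
Qed.

Lemma distxx M x : d x x = 0%E.
Proof. by rewrite (dist_model M); exact: path_distxx (@edge_step_ge0 M) _. Qed.

Lemma in_segP (L s : \bar R) : s \in `[0%E, L] ->
  s = +oo%E /\ L = +oo%E \/ exists2 r : R, s = r%:E & (0 <= r) /\ (r%:E <= L)%E.
Proof.
rewrite in_itv /=; case: s => [r| |] /andP[] //.
- by rewrite lee_fin => r0 rL; right; exists r.
- by move=> _; rewrite leye_eq => /eqP; left.
Qed.

Lemma in_segE (L : \bar R) (r : R) : (r%:E \in `[0%E, L]) = (0 <= r) && (r%:E <= L)%E.
Proof. by rewrite in_itv /= lee_fin. Qed.

Lemma in_openE (L : \bar R) (r : R) : (r%:E \in `]0%E, L[) = (0 < r) && (r%:E < L)%E.
Proof. by rewrite in_itv /= lte_fin. Qed.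

Lemma in_openP (L s : \bar R) : s \in `]0%E, L[ ->
  exists2 r : R, s = r%:E & (0 < r) /\ (r%:E < L)%E.
Proof.
rewrite in_itv /=; case: s => [r| |] /andP[] //.
- by rewrite lte_fin => r0 rL; exists r.
- by case: L.
Qed.

Lemma len_itv0 M (e : edge M) : 0%E \in `[0%E, len e].
Proof. by rewrite in_itv /= lexx ltW ?len_gt0. Qed.

Lemma len_itvl M (e : edge M) : len e \in `[0%E, len e].
Proof. by rewrite in_itv /= lexx ltW ?len_gt0. Qed.

Lemma open_closed (L s : \bar R) : s \in `]0%E, L[ -> s \in `[0%E, L].
Proof. by rewrite !in_itv /= => /andP[/ltW -> /ltW ->]. Qed.

Lemma len_fin_or_infty M (e : edge M) :
  len e = +oo%E \/ exists2 l : R, len e = l%:E & 0 < l.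
Proof.
have := len_gt0 e; case E : (len e) => [l| |] //; last by left.
by rewrite lte_fin => l0; right; exists l.
Qed.

Lemma closed_cases (M : model d) (e : edge M) s : s \in `[0%E, len e] ->
  [\/ s = 0%E, s = len e | s \in `]0%E, len e[].
Proof.
rewrite !in_itv /= => /andP[]; rewrite le_eqVlt => /orP[/eqP <-|s0]; first by constructor 1.
rewrite le_eqVlt => /orP[/eqP ->|sl]; first by constructor 2.
by constructor 3; rewrite s0.
Qed.

Lemma leaf_unique (M : model d) (e e' : edge M) b : len e = +oo%E ->
  ends e' b = ends e true -> e' = e /\ b = true.
Proof.
move=> /len_infty /mem_card1[h hE] e'b.
have := hE (e, true); have := hE (e', b).
rewrite !inE /= e'b eqxx => /esym /eqP <- /esym /eqP.
by case=> -> ->.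
Qed.

Section Glue.
Variables (M : model d) (T : Type).
Variables (p : edge M -> \bar R -> T) (q : vertex M -> T).

(** The vertices and the open edges partition the space, so the pieces can be prescribed freely;
    matching at the ends of an edge enters only in [edge_glue_ept]. *)
Lemma edge_glue_ex : exists g : X -> T, (forall v, g (vpt v) = q v) /\
  (forall e s, s \in `]0%E, len e[ -> g (ept e s) = p e s).
Proof.
have /choice[g gP] : forall x, exists t, (forall v, x = @vpt _ _ _ M v -> t = q v) /\
    (forall e s, s \in `]0%E, len e[ -> x = @ept _ _ _ M e s -> t = p e s).
  move=> x; have [[v ->]|[e [s [hs ->]]]] := model_cover M x.
    exists (q v); split=> [w /vpt_inj -> //|e s hs /esym /ept_vpt]; first by case.
  exists (p e s); split=> [v /(ept_vpt hs) []|e' s' hs' /(ept_inj hs hs')].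
  by case=> -> ->.
exists g; split=> [v|e s hs]; first exact: (gP _).1.
by have := (gP (ept e s)).2 e s hs; exact.
Qed.

Definition edge_glue : X -> T := projT1 (cid edge_glue_ex).

Lemma edge_glue_vpt v : edge_glue (vpt v) = q v.
Proof. by rewrite /edge_glue; case: cid => g []. Qed.

Lemma edge_glue_ept :
  (forall e, p e 0%E = q (ends e false)) -> (forall e, p e (len e) = q (ends e true)) ->
  forall e s, s \in `[0%E, len e] -> edge_glue (ept e s) = p e s.
Proof.
move=> p0 p1 e s /closed_cases[->|->|hs].
- by rewrite ept0 edge_glue_vpt p0.
- by rewrite ept_len edge_glue_vpt p1.
by rewrite /edge_glue; case: cid => g [_] /= ->.
Qed.

End Glue.

(** The source of all lower bounds on [d]. Real parameters suffice: a step between a point at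
    infinity and any other point of its edge has infinite length. *)
Lemma lipschitz_dist (M : model d) (g : X -> R) :
  (forall (e : edge M) (s t : R), s%:E \in `[0%E, len e] -> t%:E \in `[0%E, len e] ->
    `|g (ept e s%:E) - g (ept e t%:E)| <= `|s - t|) ->
  forall x y, (`|g x - g y|%:E <= d x y)%E.
Proof.
move=> gL x y; rewrite (dist_model M); apply/ereal_infP => a /=.
elim=> {x y a} [x|x y z a b [e [s [t [hs ht -> -> ->]]]] _ IH].
  by rewrite subrr normr0.
have st : (`|g (ept e s) - g (ept e t)|%:E <= seg_length s t)%E.
  case: (in_segP hs) => [[-> _]|[s' es hs']]; case: (in_segP ht) => [[-> _]|[t' et ht']].
  - by rewrite subrr normr0 seg_length_ge0.
  - by rewrite et seg_length_pinftyl ?leey.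
  - by rewrite es seg_length_pinftyr ?leey.
  - by rewrite es et seg_lengthE lee_fin; apply: gL; rewrite -?es -?et.
apply: le_trans (leeD st IH); rewrite -EFinD lee_fin.
exact: ler_distD.
Qed.

End ModelBasics.

(** * Subdivision of models *)

Lemma adde_continuous (R : realType) (c : R) : continuous (fun s : \bar R => (s + c%:E)%E).
Proof.
move=> s; apply: cvgeD; [by rewrite fin_num_adde_defl|exact: cvg_id|exact: cvg_cst].
Qed.

Lemma in_shift (R : realType) (L s : \bar R) (c : R) : (0 < c) -> (c%:E < L)%E ->
  s \in `[0%E, (L - c%:E)%E] -> (s + c%:E)%E \in `[c%:E, L].
Proof.
move=> c0 cL; rewrite !in_itv /= EFinN leeBrDr // => /andP[s0 ->].
by rewrite andbT leeDr.
Qed.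

Lemma seg_length_shift (R : realType) (s t : \bar R) (c : R) : (0 <= s)%E -> (0 <= t)%E ->
  seg_length (s + c%:E) (t + c%:E) = seg_length s t.
Proof.
case: s => [s| |] //; case: t => [t| |] // _ _.
by rewrite -!EFinD !seg_lengthE opprD addrACA subrr addr0.
Qed.

Section Subdivision.
Context {R : realType} {X : topologicalType} {d : X -> X -> \bar R}.
Variables (M : model d) (e0 : edge M) (c : R).
Hypothesis hc : c%:E \in `]0%E, len e0[.

Let c0 : 0 < c. Proof. by move: hc; rewrite in_openE => /andP[]. Qed.
Let cL : (c%:E < len e0)%E. Proof. by move: hc; rewrite in_openE => /andP[]. Qed.

(** The vertex [None] is the cut point. The edge [Some e0] keeps the part of [e0] below [c], and the
    edge [None] is the part above, with parameter shifted by [c]; orientations persist, so an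
    infinite end stays at +oo. *)
Definition sub_ends (e : option (edge M)) (b : bool) : option (vertex M) :=
  if e is Some e then if (e == e0) && b then None else Some (ends e b)
  else if b then Some (ends e0 true) else None.

Definition sub_len (e : option (edge M)) : \bar R :=
  if e is Some e then if e == e0 then c%:E else len e else (len e0 - c%:E)%E.

Let sub_adjacent (u v : option (vertex M)) :=
  [exists e, exists b, (sub_ends e b == u) && (sub_ends e (~~ b) == v)].

Let sub_adjacent_sym : symmetric sub_adjacent.
Proof.
suff H u v : sub_adjacent u v -> sub_adjacent v u by move=> u v; apply/idP/idP; exact: H.
move=> /existsP[e /existsP[b /andP[h1 h2]]]; apply/existsP; exists e.
by apply/existsP; exists (~~ b); rewrite negbK h1 h2.
Qed.

Let sub_connect_sym : connect_sym sub_adjacent.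
Proof. exact/sym_connect_sym/sub_adjacent_sym. Qed.

Let sub_adj e b : connect sub_adjacent (sub_ends e b) (sub_ends e (~~ b)).
Proof.
by apply: connect1; apply/existsP; exists e; apply/existsP; exists b; rewrite !eqxx.
Qed.

Let sub_connected u v : connect sub_adjacent u v.
Proof.
have e0E b : connect sub_adjacent None (Some (ends e0 b)).
  case: b; first exact: (sub_adj None false).
  by have := sub_adj (Some e0) true; rewrite /= eqxx.
have H a b : connect sub_adjacent (Some a) (Some b).
  have /connectP[p pP ->] := wgraph_connected a b.
  elim: p a pP => [|z p IH] a //= /andP[/existsP[e /existsP[s /andP[/eqP <- /eqP <-]]] /IH].
  apply: connect_trans; have [->|ne] := eqVneq e e0.
    by rewrite sub_connect_sym; apply: connect_trans (e0E s); rewrite sub_connect_sym.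
  by have := sub_adj (Some e) s; rewrite /= (negbTE ne).
have HN a : connect sub_adjacent None (Some a) by apply: connect_trans (e0E true) (H _ _).
case: u => [a|]; case: v => [b|]; [exact: H| |exact: HN|exact: connect0].
by rewrite sub_connect_sym; exact: HN.
Qed.

Let sub_len_gt0 e : (0 < sub_len e)%E.
Proof.
case: e => [e|] /=; last by rewrite EFinN sube_gt0.
by case: ifP => _; rewrite ?lte_fin ?len_gt0.
Qed.

Let sub_len_infty e : sub_len e = +oo%E ->
  #|[pred h : option (edge M) * bool | sub_ends h.1 h.2 == sub_ends e true]| = 1%N.
Proof.
move=> h; apply: (@fintype.eq_card1 _ (e, true)) => -[e' b]; rewrite !inE /=.
apply/eqP/eqP; last by case=> -> ->.
case: e h => [e|] /= h.
  have ne : e != e0 by apply/eqP => ee; move: h; rewrite ee eqxx.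
  rewrite (negbTE ne) /= in h *.
  case: e' => [e'|] /=; first by case: ifP => // _ [] /(leaf_unique h)[-> ->].
  by case: b => // -[] /(leaf_unique h)[E]; rewrite E eqxx in ne.
have El : len e0 = +oo%E by case: (len e0) h.
case: e' => [e'|] /=; last by case: b.
by case: ifP => // ne [] /(leaf_unique El)[E1 E2]; move: ne; rewrite E1 E2 eqxx.
Qed.

Definition sub_graph : wgraph R := @WGraph R (option (vertex M)) (option (edge M))
  sub_ends sub_len (eq_ind_r (fun n => (0 < n)%N) (ltn0Sn _) (card_option _))
  sub_connected sub_len_gt0 sub_len_infty.

Definition sub_vpt (v : option (vertex M)) : X := if v is Some v then vpt v else ept e0 c%:E.

Definition sub_ept (e : option (edge M)) (s : \bar R) : X :=
  if e is Some e then ept e s else ept e0 (s + c%:E)%E.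

Let sub_ept0 e : sub_ept e 0%E = sub_vpt (sub_ends e false).
Proof. by case: e => [e|] /=; rewrite ?add0e // andbF /= ept0. Qed.

Let sub_ept_len e : sub_ept e (sub_len e) = sub_vpt (sub_ends e true).
Proof.
case: e => [e|] /=; last by rewrite EFinN subeK // ept_len.
by rewrite andbT; case: eqP => [->|_] //; rewrite ept_len.
Qed.

Let sub_vpt_inj : injective sub_vpt.
Proof.
move=> [v|] [w|] //= => [/vpt_inj -> //|/esym E|E]; by case: (ept_vpt hc E).
Qed.

Let old_edge (e : option (edge M)) := if e is Some e then e else e0.
Let old_param (e : option (edge M)) (s : \bar R) := if e is Some e then s else (s + c%:E)%E.

Let sub_eptE e s : sub_ept e s = ept (old_edge e) (old_param e s).
Proof. by case: e. Qed.

Let old_open e s : s \in `]0%E, sub_len e[ -> old_param e s \in `]0%E, len (old_edge e)[.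
Proof.
case: e => [e|] /=.
  case: eqP => [->|_] //; rewrite !in_itv /= => /andP[-> /lt_trans]; exact.
rewrite !in_itv /= EFinN lteBrDr // => /andP[s0 ->]; rewrite andbT.
by apply: adde_gt0; rewrite ?lte_fin.
Qed.

Let old_param_range e s : s \in `]0%E, sub_len e[ ->
  if e is Some e then e = e0 -> (old_param (Some e) s < c%:E)%E
  else (c%:E < old_param None s)%E.
Proof.
case: e => [e|] /=; rewrite in_itv /= => /andP[s0 sL]; last by rewrite lteDr.
by move=> ee; move: sL; rewrite ee eqxx.
Qed.

Let sub_ept_inj e e' s s' : s \in `]0%E, sub_len e[ -> s' \in `]0%E, sub_len e'[ ->
  sub_ept e s = sub_ept e' s' -> e = e' /\ s = s'.
Proof.
move=> hs hs'; rewrite !sub_eptE => /(ept_inj (old_open hs) (old_open hs')).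
have := old_param_range hs; have := old_param_range hs'.
case: e {hs} => [e|]; case: e' {hs'} => [e'|] /=.
- by move=> _ _ [-> ->].
- by move=> cs' + [ee E]; rewrite E => /(_ ee) /(lt_trans cs'); rewrite ltxx.
- by move=> + cs [ee E]; rewrite E in cs * => /(_ (esym ee)) /(lt_trans cs); rewrite ltxx.
- move=> _ _ [_] /(congr1 (fun x => x - c%:E)%E).
  by rewrite !addeK.
Qed.

Let sub_ept_vpt e s v : s \in `]0%E, sub_len e[ -> sub_ept e s <> sub_vpt v.
Proof.
move=> hs; rewrite sub_eptE; case: v => [v|] /=; first exact/ept_vpt/old_open.
move=> /(ept_inj (old_open hs) hc).
have := old_param_range hs; case: e {hs} => [e|] /= + [E1 E2].
  by move=> /(_ E1); rewrite E2 ltxx.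
by rewrite E2 ltxx.
Qed.

Let sub_cover x : (exists v, x = sub_vpt v) \/
  (exists e s, (s \in `]0%E, sub_len e[) /\ x = sub_ept e s).
Proof.
have [[v ->]|[e [s [hs ->]]]] := model_cover M x; first by left; exists (Some v).
have [ee|ne] := eqVneq e e0; last first.
  by right; exists (Some e), s; rewrite /= (negbTE ne).
have [s0 sL] : (0 < s)%E /\ (s < len e0)%E by move: hs; rewrite in_itv -ee => /andP.
have [sc|sc|sc] := ltgtP s c%:E.
- by right; exists (Some e), s; rewrite /= ee eqxx in_itv /= s0.
- right; exists None, (s - c%:E)%E; rewrite /= EFinN subeK // ee; split=> //.
  rewrite in_itv /= EFinN sube_gt0 // sc.
  by rewrite lteD2rE.
- by left; exists None; rewrite sc ee.
Qed.

Let sub_len_le e s : s \in `[0%E, sub_len e] -> old_param e s \in `[0%E, len (old_edge e)].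
Proof.
case: e => [e|] /=.
  case: eqP => [->|_] //; rewrite !in_itv /= => /andP[-> /le_trans]; apply.
  exact: ltW.
move=> /(in_shift c0 cL); rewrite !in_itv /= => /andP[cs ->].
by rewrite (le_trans _ cs) // lee_fin ltW.
Qed.

Let sub_open (U : set X) : open U <->
  forall e, open (sub_ept e @^-1` U : set (subspace `[0%E, sub_len e])).
Proof.
rewrite (open_model M); split=> H e.
  have /open_subspaceP[V oV VE] := H (old_edge e).
  apply/open_subspaceP; exists (old_param e @^-1` V).
    have /continuousP : continuous (old_param e); last by apply.
    case: e {VE} => [e|] /=; [by move=> ? ?|exact: adde_continuous].
  apply/seteqP; split=> s [h hs]; split=> //.
    have : (V `&` `[0%E, len (old_edge e)]) (old_param e s) by split=> //; exact: sub_len_le.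
    by rewrite VE /= sub_eptE => -[].
  have : (ept (old_edge e) @^-1` U `&` `[0%E, len (old_edge e)]) (old_param e s).
    by split; [rewrite /= -sub_eptE|exact: sub_len_le].
  by rewrite -VE => -[].
have [->{e}|ne] := eqVneq e e0; last first.
  have /open_subspaceP[V oV VE] := H (Some e); apply/open_subspaceP; exists V => //.
  by move: VE; rewrite /= (negbTE ne).
have /open_subspaceP[V1 oV1] := H (Some e0).
have /open_subspaceP[V2 oV2] := H None.
rewrite /= eqxx => /seteqP[V2s V2e] /seteqP[V1s V1e].
pose V2' : set (\bar R) := (fun s => s - c%:E)%E @^-1` V2.
have oV2' : open V2'.
  move/continuousP: (@adde_continuous R (- c)) => /(_ _ oV2).
  by congr open; apply/seteqP; split=> s; rewrite /V2' /= EFinN.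
have V1P s : (0 <= s)%E -> (s <= c%:E)%E -> V1 s <-> U (ept e0 s).
  move=> s0 sc; have hs : s \in `[0%E, c%:E] by rewrite in_itv /= s0.
  by split=> h; [case: (V1s s)|case: (V1e s)].
have V2P s : (c%:E <= s)%E -> (s <= len e0)%E -> V2' s <-> U (ept e0 s).
  move=> cs sL; have hs : (s - c%:E)%E \in `[0%E, (len e0 - c%:E)%E].
    by rewrite in_itv /= !EFinN sube_ge0 // cs leeD2r.
  have sE : (s - c%:E + c%:E)%E = s by rewrite subeK.
  split=> h; first by have [] := V2s _ (conj h hs); rewrite /= sE.
  by case: (V2e (s - c%:E)%E) => //; split=> //=; rewrite sE.
apply/open_subspaceP.
(* [V1] and [V2'] describe [U] only on their own side of [c], so each is cut off there; their
   intersection supplies a neighbourhood of [c] itself. *)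
exists ((V1 `&` [set s | (s < c%:E)%E]) `|` (V2' `&` [set s | (c%:E < s)%E]) `|` (V1 `&` V2')).
  apply: openU; last exact: openI.
  apply: openU; apply: openI => //; [exact: open_ereal_lt_ereal|exact: open_ereal_gt_ereal].
apply/seteqP; split=> s [h hs]; split=> //; move: (hs);
  rewrite /= in_itv /= => /andP[s0 sL].
  case: h => [[[h /= sc]|[h /= cs]]|[h1 h2]].
  - by apply/V1P => //; exact: ltW.
  - by apply/V2P => //; exact: ltW.
  - by have [sc|/ltW cs] := leP s c%:E; [apply/V1P|apply/V2P].
have [sc|cs|sc] := ltgtP s c%:E.
- by left; left; split=> //; apply/V1P => //; exact: ltW.
- by left; right; split=> //; apply/V2P => //; exact: ltW.
- by right; split; [apply/V1P|apply/V2P]; rewrite // sc.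
Qed.

Let step0 : nonneg_step (edge_step (G := sub_graph) sub_ept).
Proof. by move=> x y a [e [s [t [_ _ _ _ ->]]]]; exact: seg_length_ge0. Qed.

(** A step of the subdivision is a step of [M] after shifting the parameter. Conversely, a step
    across the cut is replaced by two steps through the cut point, whose lengths add up. *)
Let sub_dist x y : d x y = path_dist (edge_step (G := sub_graph) sub_ept) x y.
Proof.
apply/eqP; rewrite eq_le; apply/andP; split; rewrite (dist_model M).
  apply: (path_dist_le (h := id)); first exact: edge_step_ge0.
  move=> {x y} x y a [e [s [t [hs ht -> -> ->]]]]; rewrite !sub_eptE.
  have -> : seg_length s t = seg_length (old_param e s) (old_param e t).
    case: e hs ht => [//|] hs ht /=; rewrite seg_length_shift //.
      by move: hs; rewrite in_itv => /andP[].
    by move: ht; rewrite in_itv => /andP[].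
  by rewrite -(dist_model M); apply: dist_ept; exact: sub_len_le.
apply: (path_dist_le (h := id)) => // {x y} x y a [e [s [t [hs ht -> -> ->]]]].
have [ee|ne] := eqVneq e e0; last first.
  apply: path_dist_step; exists (Some e), s, t.
  by rewrite /= (negbTE ne).
rewrite {e}ee in hs ht *.
have lower u v : u \in `[0%E, c%:E] -> v \in `[0%E, c%:E] ->
    (path_dist (edge_step (G := sub_graph) sub_ept) (ept e0 u) (ept e0 v) <= seg_length u v)%E.
  by move=> hu hv; apply: path_dist_step; exists (Some e0), u, v; rewrite /= eqxx.
have upper u v : u \in `[c%:E, len e0] -> v \in `[c%:E, len e0] ->
    (path_dist (edge_step (G := sub_graph) sub_ept) (ept e0 u) (ept e0 v) <= seg_length u v)%E.
  rewrite !in_itv /= => /andP[cu uL] /andP[cv vL]; apply: path_dist_step.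
  exists None, (u - c%:E)%E, (v - c%:E)%E; rewrite /= !EFinN !subeK //; split=> //.
  - by rewrite in_itv /= !EFinN sube_ge0 // cu leeD2r.
  - by rewrite in_itv /= !EFinN sube_ge0 // cv leeD2r.
  - by rewrite -(@seg_length_shift _ (u - c%:E) (v - c%:E) c) ?sube_ge0 // !subeK.
have cc1 : c%:E \in `[0%E, c%:E] by rewrite in_itv /= lexx lee_fin ltW.
have cc2 : c%:E \in `[c%:E, len e0] by rewrite in_itv /= lexx ltW.
move: hs ht; rewrite !in_itv /= => /andP[s0 sL] /andP[t0 tL].
have [sc|cs] := leP s c%:E; have [tc|ct] := leP t c%:E.
- by apply: lower; rewrite in_itv /= ?s0 ?t0.
- have hs : s \in `[0%E, c%:E] by rewrite in_itv /= s0.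
  have ht : t \in `[c%:E, len e0] by rewrite in_itv /= tL ltW.
  apply: le_trans (path_dist_triangle step0 _ (ept e0 c%:E) _) _.
  apply: le_trans (leeD (lower _ _ hs cc1) (upper _ _ cc2 ht)) _.
  case: s s0 sc {sL hs} => [s| |] // s0 sc; case: t ct {t0 tL ht} => [t| |] // ct.
    rewrite !seg_lengthE -EFinD !lee_fin in sc *; rewrite lte_fin in ct.
    by rewrite !ler0_norm; lra.
  by rewrite (@seg_length_pinftyr _ s%:E) // leey.
- have hs : s \in `[c%:E, len e0] by rewrite in_itv /= sL ltW.
  have ht : t \in `[0%E, c%:E] by rewrite in_itv /= t0.
  apply: le_trans (path_dist_triangle step0 _ (ept e0 c%:E) _) _.
  apply: le_trans (leeD (upper _ _ hs cc2) (lower _ _ cc1 ht)) _.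
  case: t t0 tc {tL ht} => [t| |] // t0 tc; case: s cs {s0 sL hs} => [s| |] // cs.
    rewrite !seg_lengthE -EFinD !lee_fin in tc *; rewrite lte_fin in cs.
    by rewrite !ger0_norm; lra.
  by rewrite (@seg_length_pinftyl _ t%:E) // leey.
- by apply: upper; rewrite in_itv /= ?sL ?tL ltW.
Qed.

Definition subdivision : model d := @Model R X d sub_graph sub_vpt sub_ept
  sub_ept0 sub_ept_len sub_vpt_inj sub_ept_inj sub_ept_vpt sub_cover sub_open sub_dist.

End Subdivision.

Section Refinement.
Context {R : realType} {X : topologicalType} {d : X -> X -> \bar R}.
Implicit Types M : model d.

(** Only translations of the parameter are allowed, because [subdivision] preserves orientations; a
    function affine on an edge of [M] keeps its integer slope on the pieces. *)
Definition refines M' M : Prop := forall e' : edge M', exists (e : edge M) (c : R),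
  [/\ 0 <= c, (len e' + c%:E <= len e)%E
    & forall s : \bar R, s \in `[0%E, len e'] -> ept e' s = ept e (s + c%:E)%E].

Lemma refines_refl M : refines M M.
Proof. by move=> e; exists e, 0; rewrite adde0; split=> // s _; rewrite adde0. Qed.

Lemma refines_trans M2 M1 M : refines M2 M1 -> refines M1 M -> refines M2 M.
Proof.
move=> r21 r1 e2; have [e1 [c1 [c10 l1 E1]]] := r21 e2; have [e [c [c0 l E]]] := r1 e1.
exists e, (c1 + c); split; first exact: addr_ge0.
  by rewrite EFinD addeA; apply: le_trans l; rewrite leeD2r.
move=> s hs; rewrite E1 // E ?EFinD ?addeA //.
move: hs; rewrite !in_itv /= => /andP[s0 sl].
by rewrite adde_ge0 //= (le_trans _ l1) // leeD2r.
Qed.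

Definition is_vertex M (x : X) : Prop := exists v : vertex M, x = vpt v.

Lemma refine_point M (p : X) : exists2 M' : model d, refines M' M &
  forall x, is_vertex M' x <-> is_vertex M x \/ x = p.
Proof.
have [pV|[e [s [hs pE]]]] := model_cover M p.
  exists M; first exact: refines_refl.
  by move=> x; split=> [|[//|->//]]; left.
have [c sE _] := in_openP hs; rewrite sE in hs pE.
exists (subdivision hs).
  case=> [e'|].
    exists e', 0; rewrite adde0; split=> // [|t _]; last by rewrite adde0.
    by rewrite /=; case: eqP => [->|//]; move: hs; rewrite in_itv /= => /andP[_ /ltW].
  have /andP[c0 cl] : (0 < c) && (c%:E < len e)%E by rewrite -in_openE.
  by exists e, c; split=> //=; [exact: ltW|rewrite EFinN subeK].
move=> x; split=> [[[v|] ->]|[[v ->]|->]].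
- by left; exists v.
- by right.
- by exists (Some v).
- by exists None.
Qed.

Lemma refine_points M (ps : seq X) : exists2 M' : model d, refines M' M &
  forall x, is_vertex M' x <-> is_vertex M x \/ x \in ps.
Proof.
elim: ps => [|p ps [M1 r1 v1]].
  by exists M; [exact: refines_refl|move=> x; split=> [|[]//]; left].
have [M2 r2 v2] := refine_point M1 p; exists M2; first exact: refines_trans r2 r1.
move=> x; rewrite v2 v1 inE; split=> [[[h|h]|->]|[h|/orP[/eqP ->|h]]].
- by left.
- by right; rewrite h orbT.
- by right; rewrite eqxx.
- by left; left.
- by right.
- by left; right.
Qed.

End Refinement.

(** * Distance to the vertices *)

Lemma ler_dist_min (R : realType) (a b a' b' c : R) :
  `|a - a'| <= c -> `|b - b'| <= c -> `|Num.min a b - Num.min a' b'| <= c.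
Proof.
rewrite !ler_norml => /andP[h1 h2] /andP[h3 h4].
by case: (leP a b) => ?; case: (leP a' b') => ?; apply/andP; split; lra.
Qed.

Lemma ler_dist_max (R : realType) (a b a' b' c : R) :
  `|a - a'| <= c -> `|b - b'| <= c -> `|Num.max a b - Num.max a' b'| <= c.
Proof.
rewrite !ler_norml => /andP[h1 h2] /andP[h3 h4].
by case: (leP a b) => ?; case: (leP a' b') => ?; apply/andP; split; lra.
Qed.

Section VertexDistance.
Context {R : realType} {X : topologicalType} {d : X -> X -> \bar R}.
Variable M : model d.
Implicit Types (e : edge M) (v : vertex M).

(* [fine +oo = 0], so [edge_tent e] and [vdist] vanish at the points at
   infinity too. *)
Definition edge_tent e (s : \bar R) : R :=
  if len e is l%:E then Num.min (fine s) (l - fine s) else fine s.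

Definition vdist : X -> R := edge_glue edge_tent (fun=> 0).

Lemma edge_tent0 e : edge_tent e 0%E = 0.
Proof.
rewrite /edge_tent; have [->|[l -> l0]] := len_fin_or_infty e => //=.
by rewrite subr0 min_l // ltW.
Qed.

Lemma edge_tent_len e : edge_tent e (len e) = 0.
Proof.
rewrite /edge_tent; have [->|[l -> l0]] := len_fin_or_infty e => //=.
by rewrite subrr min_r // ltW.
Qed.

Lemma vdist_vpt v : vdist (vpt v) = 0.
Proof. exact: edge_glue_vpt. Qed.

Lemma vdist_ept e s : s \in `[0%E, len e] -> vdist (ept e s) = edge_tent e s.
Proof.
by move=> hs; rewrite /vdist edge_glue_ept // => {hs s}e; rewrite ?edge_tent0 ?edge_tent_len.
Qed.

Lemma edge_tent_ge0 e s : s \in `[0%E, len e] -> 0 <= edge_tent e s.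
Proof.
rewrite /edge_tent => /in_segP[[-> ->]//|[r -> [r0]]] /=.
case: (len e) => [l| |] //=; rewrite lee_fin => rl.
by rewrite le_min r0 subr_ge0.
Qed.

Lemma edge_tent_gt0 e s : s \in `]0%E, len e[ -> 0 < edge_tent e s.
Proof.
rewrite /edge_tent => /in_openP[r -> [r0]] /=.
case: (len e) => [l| |] //=; rewrite lte_fin => rl.
by rewrite lt_min r0 subr_gt0.
Qed.

Lemma edge_tent_le e s : s \in `[0%E, len e] -> edge_tent e s <= fine s.
Proof.
rewrite /edge_tent => /in_segP[[-> ->]//|[r -> [r0]]] /=.
by case: (len e) => [l| |] //= _; rewrite ge_min lexx.
Qed.

Lemma edge_tent_lipschitz e (s t : R) : s%:E \in `[0%E, len e] -> t%:E \in `[0%E, len e] ->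
  `|edge_tent e s%:E - edge_tent e t%:E| <= `|s - t|.
Proof.
move=> _ _; rewrite /edge_tent; case: (len e) => [l| |] //=.
apply: ler_dist_min => //.
by rewrite opprD opprK addrACA subrr add0r addrC distrC.
Qed.

Lemma vdist_ge0 x : 0 <= vdist x.
Proof.
have [[v ->]|[e [s [hs ->]]]] := model_cover M x; first by rewrite vdist_vpt.
by rewrite vdist_ept ?edge_tent_ge0 // open_closed.
Qed.

Lemma vdist_lipschitz x y : (`|vdist x - vdist y|%:E <= d x y)%E.
Proof.
apply: (@lipschitz_dist _ _ _ M) => e s t hs ht.
by rewrite !vdist_ept //; exact: edge_tent_lipschitz.
Qed.

Lemma vdist_le x v : ((vdist x)%:E <= d x (vpt v))%E.
Proof.
by have := vdist_lipschitz x (vpt v); rewrite vdist_vpt subr0 ger0_norm ?vdist_ge0.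
Qed.

(** With [vdist_le], this describes [vdist] by [d] and the vertex set alone, which is why isometries
    preserving the vertices preserve it. *)
Lemma vdist_attained x : exists v, (d x (vpt v) <= (vdist x)%:E)%E.
Proof.
have [[v ->]|[e [s [hs ->]]]] := model_cover M x.
  by exists v; rewrite vdist_vpt (distxx M).
have hs' := open_closed hs; rewrite vdist_ept //.
have [r er [r0 rl]] := in_openP hs; rewrite er in hs hs' *.
have h0 : (d (ept e r%:E) (vpt (ends e false)) <= r%:E)%E.
  rewrite -ept0; apply: le_trans (dist_ept hs' (len_itv0 e)) _.
  by rewrite seg_lengthE subr0 gtr0_norm.
rewrite /edge_tent /=; have [->|[l El l0]] := len_fin_or_infty e.
  by exists (ends e false).
rewrite El /=; case: (leP r (l - r)) => h; first by exists (ends e false).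
exists (ends e true); rewrite -ept_len.
apply: le_trans (dist_ept hs' (len_itvl e)) _.
move: rl; rewrite El lte_fin seg_lengthE lee_fin => rl.
by rewrite ler0_norm; lra.
Qed.

Section NearEdge.
Variables (e : edge M) (a : R).
Hypothesis ha : a%:E \in `]0%E, len e[.

Let ra := edge_tent e a%:E.

(* A path from [ept e a%:E] stays on [e] or visits a vertex; in the latter case its
   length is at least [ra] plus the tent at the other end. *)
Definition near_edge e' (t : \bar R) : R :=
  if e' == e then Num.min `|fine t - a| (ra + edge_tent e t)
  else ra + edge_tent e' t.

(** The tent at [a] is at most [a] and, on a finite edge, at most [len e - a]; hence the minimum in
    [near_edge] equals [ra] at both ends and the pieces match. *)
Let near := edge_glue near_edge (fun=> ra).

Let nearE e' t : t \in `[0%E, len e'] -> near (ept e' t) = near_edge e' t.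
Proof.
have [r0 rl] : 0 < a /\ (a%:E < len e)%E by have [r [->]] := in_openP ha.
move=> ht; rewrite /near edge_glue_ept // => {ht t}{}e'.
  rewrite /near_edge; case: eqP => _; rewrite ?edge_tent0 addr0 //.
  by rewrite sub0r normrN gtr0_norm // min_r // /ra edge_tent_le // open_closed.
rewrite /near_edge; case: eqP => [->|_]; rewrite ?edge_tent_len addr0 //.
rewrite min_r // /ra /edge_tent /=; have [->|[l El l0]] := len_fin_or_infty e.
  by rewrite /= sub0r normrN gtr0_norm.
by rewrite El /= ge_min ler_norm orbT.
Qed.

Let near_dist y : ((near y)%:E <= d (ept e a%:E) y)%E.
Proof.
have hac := open_closed ha.
have near0 : near (ept e a%:E) = 0.
  by rewrite nearE // /near_edge eqxx subrr normr0 min_l // addr_ge0 ?edge_tent_ge0.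
apply: le_trans (@lipschitz_dist _ _ _ M near _ (ept e a%:E) y).
  by rewrite near0 sub0r normrN lee_fin ler_norm.
move=> e' s t hs ht; rewrite !nearE // /near_edge.
case: eqP hs ht => [->|_] hs ht /=; last first.
  by rewrite opprD addrACA subrr add0r edge_tent_lipschitz.
apply: ler_dist_min; last by rewrite opprD addrACA subrr add0r edge_tent_lipschitz.
apply: le_trans (ler_dist_dist _ _) _.
by rewrite opprB addrA subrK.
Qed.

Lemma dist_same_edge t : t%:E \in `[0%E, len e] ->
  ((Num.min `|a - t| (edge_tent e a%:E + edge_tent e t%:E))%:E
     <= d (ept e a%:E) (ept e t%:E))%E.
Proof.
by move=> ht; apply: le_trans (near_dist _); rewrite nearE // /near_edge eqxx distrC.
Qed.

Lemma dist_other_edge e' t : e' != e -> t \in `[0%E, len e'] ->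
  ((edge_tent e a%:E + edge_tent e' t)%:E <= d (ept e a%:E) (ept e' t))%E.
Proof.
move=> /negbTE ne ht; apply: le_trans (near_dist _).
by rewrite nearE // /near_edge ne.
Qed.

End NearEdge.

(** The factor 2 keeps the collars of width [delta] at the two ends of an edge from overlapping. *)
Lemma half_min_len : exists2 delta : R, 0 < delta & forall e, ((delta *+ 2)%:E <= len e)%E.
Proof.
suff [delta d0 dP] : exists2 delta : R, 0 < delta &
    forall e, e \in enum (edge M) -> ((delta *+ 2)%:E <= len e)%E.
  by exists delta => // e; apply: dP; rewrite mem_enum.
elim: (enum _) => [|e es [delta d0 IH]]; first by exists 1.
have [El|[l El l0]] := len_fin_or_infty e.
  exists delta => // e'; rewrite inE => /orP[/eqP ->|/IH //].
  by rewrite El leey.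
exists (Num.min delta (l / 2)); first by rewrite lt_min d0 divr_gt0.
move=> e'; rewrite inE => /orP[/eqP ->|/IH h].
  by rewrite El lee_fin; case: (leP delta (l / 2)) => ?; lra.
apply: le_trans h; rewrite lee_fin.
by case: (leP delta (l / 2)) => ?; lra.
Qed.

Section VertexBump.
Variables (delta : R) (d0 : 0 < delta) (dP : forall e, ((delta *+ 2)%:E <= len e)%E).
Variable u : vertex M.

(** Along an edge, [delta] minus the distance to an end at [u], cut off at 0. The maximum covers a
    loop, both of whose ends are [u]; the far end of an infinite edge contributes nothing. *)
Definition vbump_edge e (t : \bar R) : R :=
  if t is r%:E then
    Num.max (if ends e false == u then Num.max 0 (delta - r) else 0)
      (if len e is l%:E then if ends e true == u then Num.max 0 (delta - (l - r)) else 0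
       else 0)
  else 0.

(* A leaf at infinity has to be excluded: [vbump_edge e +oo = 0]. *)
Definition vbump : X -> R := edge_glue vbump_edge (fun v =>
  if (v == u) && ~~ [exists e, (len e == +oo%E) && (ends e true == u)] then delta else 0).

Lemma vbump_ept e t : t \in `[0%E, len e] -> vbump (ept e t) = vbump_edge e t.
Proof.
move=> ht; rewrite /vbump edge_glue_ept // => {ht t}{}e; last first.
  have [El|[l El l0]] := len_fin_or_infty e.
    rewrite El /=; case: eqP => //= eu; case: ifP => // /existsP[].
    by exists e; rewrite El eu !eqxx.
  have := dP e; rewrite El lee_fin => dl.
  rewrite /vbump_edge El subrr subr0 (max_r (ltW d0)) (max_l (y := delta - l)); last by lra.
  rewrite if_same max_r; last by case: ifP => // _; exact: ltW.
  case: eqP => //= eu; case: existsP => // -[e' /andP[/eqP E' /eqP e'u]].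
  have [ee _] := leaf_unique E' (etrans eu (esym e'u)).
  by move: El; rewrite ee E'.
have h : (if ends e false == u then delta else 0) = vbump_edge e 0%E.
  rewrite /vbump_edge /= subr0 (max_r (ltW d0)).
  have p0 : 0 <= (if ends e false == u then delta else 0) by case: ifP => // _; exact: ltW.
  have [El|[l El l0]] := len_fin_or_infty e; first by rewrite El max_l.
  have := dP e; rewrite El lee_fin => dl.
  by rewrite /= subr0 (max_l (y := delta - l)) ?if_same ?max_l //; lra.
rewrite -h; case: eqP => //= eu; case: existsP => // -[e' /andP[/eqP E' /eqP e'u]].
by have [] := leaf_unique E' (etrans eu (esym e'u)).
Qed.

Lemma vbump_vpt_gt0 v : 0 < vbump (vpt v) -> v = u.
Proof. by rewrite /vbump edge_glue_vpt; case: eqP => //=; rewrite ltxx. Qed.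

Lemma vbump_vpt_self : (forall e, len e = +oo%E -> ends e true <> u) ->
  vbump (vpt u) = delta.
Proof.
move=> hu; rewrite /vbump edge_glue_vpt eqxx /=; case: existsP => // -[e /andP[/eqP /hu]].
by move=> + /eqP.
Qed.

Lemma vbump_lipschitz x y : (`|vbump x - vbump y|%:E <= d x y)%E.
Proof.
apply: (@lipschitz_dist _ _ _ M) => e s t hs ht.
rewrite !vbump_ept // /vbump_edge; apply: ler_dist_max.
  case: ifP => _; last by rewrite subrr normr0.
  apply: ler_dist_max; first by rewrite subrr normr0.
  by rewrite opprD opprK addrACA subrr add0r addrC distrC.
case: (len e) => [l| |]; rewrite ?subrr ?normr0 //.
case: ifP => _; last by rewrite subrr normr0.
apply: ler_dist_max; first by rewrite subrr normr0.
by rewrite [X in `|X|](_ : _ = s - t) //; lra.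
Qed.

End VertexBump.
End VertexDistance.

(** * Isometries preserving the vertices permute the edges *)

Section VdistInvariance.
Context {R : realType} {X : topologicalType} {d : X -> X -> \bar R}.
Variables (M : model d) (h : X -> X).
Hypothesis hd : forall x y, d (h x) (h y) = d x y.
Hypothesis hv : forall v : vertex M, exists w : vertex M, h (vpt v) = vpt w.

Lemma vdist_isom_le x : vdist M (h x) <= vdist M x.
Proof.
have [v] := vdist_attained M x; have [w hw] := hv v.
by rewrite -hd hw -lee_fin; apply: le_trans; exact: vdist_le.
Qed.

End VdistInvariance.

Section IsometryEdges.
Context {R : realType} {X : topologicalType} {d : X -> X -> \bar R}.
Variable M : model d.

(** The inverse is carried along with the same properties, so each one-sided estimate also applies
    to it. *)
Definition vertex_isom (h g : X -> X) : Prop :=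
  [/\ cancel h g, cancel g h, continuous h /\ continuous g,
      forall x y, d (h x) (h y) = d x y
    & (forall v : vertex M, exists w : vertex M, h (vpt v) = vpt w) /\
      (forall v : vertex M, exists w : vertex M, g (vpt v) = vpt w)].

Lemma vertex_isom_sym h g : vertex_isom h g -> vertex_isom g h.
Proof. by case=> hg gh [ch cg] hd [hv gv]; split=> // x y; rewrite -hd !gh. Qed.

Lemma vdist_isom h g : vertex_isom h g -> forall x, vdist M (h x) = vdist M x.
Proof.
move=> H x; have [_ _ _ gd [gv _]] := vertex_isom_sym H.
case: H => hg _ _ hd [hv _]; apply/eqP; rewrite eq_le (vdist_isom_le hd hv).
by rewrite -{1}(hg x) (vdist_isom_le gd gv).
Qed.

Lemma isom_interior h g (e : edge M) s : vertex_isom h g -> s \in `]0%E, len e[ ->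
  exists (e' : edge M) (s' : \bar R), (s' \in `]0%E, len e'[) /\ h (ept e s) = ept e' s'.
Proof.
case=> hg _ _ _ [_ gv] hs; have [[v E]|//] := model_cover M (h (ept e s)).
have [w gw] := gv v; case: (ept_vpt hs (v := w)).
by rewrite -gw -E hg.
Qed.

(** If the images lay on different edges, [dist_other_edge] and the invariance of [vdist] would put
    them at distance at least the sum of the tents at [a] and [t], which exceeds [|a - t|]. *)
Lemma isom_near h g (e e' : edge M) (a t : R) s' : vertex_isom h g ->
  a%:E \in `]0%E, len e[ -> t%:E \in `]0%E, len e[ -> (`|a - t| < edge_tent e a%:E) ->
  s' \in `]0%E, len e'[ -> h (ept e a%:E) = ept e' s' ->
  exists2 t' : \bar R, t' \in `]0%E, len e'[ & h (ept e t%:E) = ept e' t'.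
Proof.
move=> H ha ht at_lt hs' E.
have [e'' [t' [ht' Et]]] := isom_interior H ht.
have [<-|ne] := eqVneq e'' e'; first by exists t'.
have [r es' _] := in_openP hs'; rewrite es' in hs' E.
have := dist_other_edge hs' ne (open_closed ht').
rewrite -(vdist_ept (open_closed hs')) -(vdist_ept (open_closed ht')) -E -Et.
rewrite !(vdist_isom H) !vdist_ept ?open_closed //.
case: H => _ _ _ -> _ h1; move: (le_trans h1 (dist_ept (open_closed ha) (open_closed ht))).
rewrite seg_lengthE lee_fin => h2.
by have := edge_tent_gt0 ht; lra.
Qed.

Lemma isom_edge_into h g (e : edge M) : vertex_isom h g -> exists e' : edge M,
  forall s : \bar R, s \in `]0%E, len e[ ->
    exists2 s' : \bar R, s' \in `]0%E, len e'[ & h (ept e s) = ept e' s'.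
Proof.
move=> H; have [El|[l El l0]] := len_fin_or_infty e.
  have h1 : 1%:E \in `]0%E, len e[ by rewrite El in_openE ltr01 ltey.
  have [e' [s1 [hs1 E1]]] := isom_interior H h1; exists e' => s hs.
  have [t es [t0 tl]] := in_openP hs; rewrite es in hs *.
  (* An infinite edge has no midpoint. The tent at [t + 1] is [t + 1], large enough for both 1 and
     [t] to be near this point; so the image of [t] is on the same edge as the image of 1. *)
  have ht : (t + 1)%:E \in `]0%E, len e[ by rewrite El in_openE ltey andbT; lra.
  have tE : edge_tent e (t + 1)%:E = t + 1 by rewrite /edge_tent El.
  have [e'' [s' [hs' Et]]] := isom_interior H ht.
  have n1 : `|t + 1 - 1| < edge_tent e (t + 1)%:E by rewrite tE addrK gtr0_norm //; lra.
  have n2 : `|t + 1 - t| < edge_tent e (t + 1)%:E by rewrite tE addrAC subrr add0r normr1; lra.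
  have [u hu Eu] := isom_near H ht h1 n1 hs' Et.
  have [w hw Ew] := isom_near H ht hs n2 hs' Et.
  have [<- _] : e'' = e' /\ u = s1 by apply: ept_inj => //; rewrite -Eu.
  by exists w.
(* The tent at the midpoint is [l / 2], so every interior point of the edge is near it. *)
have hc : (l / 2)%:E \in `]0%E, len e[ by rewrite El in_openE lte_fin; apply/andP; split; lra.
have [e' [s1 [hs1 E1]]] := isom_interior H hc; exists e' => s hs.
have [t es [t0 tl]] := in_openP hs; rewrite es in hs *.
apply: (isom_near H hc hs _ hs1 E1); move: tl; rewrite El lte_fin => tl.
rewrite /edge_tent El /= lt_min !ltr_norml.
by apply/andP; split; apply/andP; split; lra.
Qed.

Lemma edge_tent_le_half (e : edge M) s l : len e = l%:E -> edge_tent e s <= l / 2.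
Proof. by rewrite /edge_tent => ->; case: (leP (fine s) (l - fine s)) => ?; lra. Qed.

(** [vdist] is preserved, reaches half the length at the midpoint of [e], and is at most half the
    length of [e'] on [e']. If [e] were infinite and [e'] of length [l'], the point of [e] at
    parameter [l'] would already be too far from the vertices. *)
Lemma isom_len_le h g (e e' : edge M) : vertex_isom h g ->
  (forall s : \bar R, s \in `]0%E, len e[ ->
    exists2 s' : \bar R, s' \in `]0%E, len e'[ & h (ept e s) = ept e' s') ->
  (len e <= len e')%E.
Proof.
move=> H into.
have tentE (s : \bar R) : s \in `]0%E, len e[ ->
    exists2 s' : \bar R, s' \in `]0%E, len e'[ & edge_tent e s = edge_tent e' s'.
  move=> hs; have [s' hs' E] := into _ hs; exists s' => //.
  by rewrite -!vdist_ept ?open_closed // -E (vdist_isom H).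
have [->|[l' El' l0']] := len_fin_or_infty e'; first by rewrite leey.
have [El|[l El l0]] := len_fin_or_infty e.
  have [|s' _] := tentE l'%:E; first by rewrite El in_openE ltey l0'.
  have := edge_tent_le_half s' El'; rewrite {2}/edge_tent El /= => + E.
  rewrite -E => ?; have l'0 : l' <= 0 by lra.
  by rewrite leNgt l0' in l'0.
have [|s' _] := tentE (l / 2)%:E.
  by rewrite El in_openE lte_fin; apply/andP; split; lra.
have := edge_tent_le_half s' El'; rewrite {2}/edge_tent El /= El' lee_fin.
by case: (leP (l / 2) (l - l / 2)) => ?; lra.
Qed.

(** The inverse sends [e'] into a single edge, which must be [e] because it contains a point that
    came from [e]; the lengths are then compared in both directions. *)
Lemma isom_edge_onto h g (e : edge M) : vertex_isom h g -> exists2 e' : edge M, len e' = len e &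
  forall s : \bar R, s \in `]0%E, len e[ ->
    exists2 s' : \bar R, s' \in `]0%E, len e'[ & h (ept e s) = ept e' s'.
Proof.
move=> H; have [e' he'] := isom_edge_into e H; exists e' => //.
have [e'' he''] := isom_edge_into e' (vertex_isom_sym H).
have [e0 h0] : exists s : \bar R, s \in `]0%E, len e[.
  have [->|[l -> l0]] := len_fin_or_infty e.
    by exists 1%:E; rewrite in_openE ltr01 ltey.
  by exists (l / 2)%:E; rewrite in_openE lte_fin; apply/andP; split; lra.
have ee : e = e''.
  have [s' hs' E] := he' _ h0; have [s'' hs'' E'] := he'' _ hs'.
  case: H => hg _ _ _ _; move: E'; rewrite -E hg.
  by case/(ept_inj h0 hs'').
apply/eqP; rewrite eq_le (isom_len_le H he') andbT ee.
exact: isom_len_le (vertex_isom_sym H) he''.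
Qed.

(** Invariance of [vdist] leaves each point of a finite edge only the parameters [s] and [l - s],
    and on an infinite edge only [s]. What remains is that fixed and flipped points cannot
    coexist. *)
Lemma isom_edge_interior h g (e : edge M) : vertex_isom h g -> exists2 e' : edge M, len e' = len e &
  (forall s : \bar R, s \in `]0%E, len e[ -> h (ept e s) = ept e' s) \/
  exists2 l : R, len e = l%:E &
    forall s : R, s%:E \in `]0%E, len e[ -> h (ept e s%:E) = ept e' (l - s)%:E.
Proof.
move=> H; have [e' EL into] := isom_edge_onto e H; exists e' => //.
have tentE (s s' : R) : s%:E \in `]0%E, len e[ -> s'%:E \in `]0%E, len e'[ ->
    h (ept e s%:E) = ept e' s'%:E -> edge_tent e s%:E = edge_tent e' s'%:E.
  by move=> hs hs' E; rewrite -!vdist_ept ?open_closed // -E (vdist_isom H).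
have [El|[l El l0]] := len_fin_or_infty e.
  left=> s hs; have [s' hs' E] := into _ hs.
  have [r er _] := in_openP hs; have [r' er' _] := in_openP hs'.
  rewrite er er' in hs hs' E *; have := tentE _ _ hs hs' E.
  by rewrite /edge_tent EL El /= E => ->.
rewrite El; rewrite El in EL into tentE.
have alt (s : R) : s%:E \in `]0%E, l%:E[ ->
    h (ept e s%:E) = ept e' s%:E \/ h (ept e s%:E) = ept e' (l - s)%:E.
  move=> hs; have [s' hs' E] := into _ hs.
  have [r' er' _] := in_openP hs'; rewrite er' in hs' E.
  have := tentE _ _ hs hs' E; rewrite /edge_tent EL El /= E => rr.
  suff [->|->] : r' = s \/ r' = l - s by [left|right].
  move: rr; case: leP => ?; case: leP => ? ?; solve [left; lra | right; lra].
have [[s1 hs1 [E1 ne1]]|same] := pselect (exists2 s1 : R, s1%:E \in `]0%E, l%:E[ &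
    h (ept e s1%:E) = ept e' (l - s1)%:E /\ s1 != l - s1); last first.
  left=> s hs; have [r er _] := in_openP hs; rewrite er in hs *.
  case: (alt _ hs) => // E; have [eq|ne] := eqVneq r (l - r); first by rewrite E -eq.
  by case: same; exists r.
right; exists l => // s hs; case: (alt _ hs) => // E2.
(* [s] is fixed while [s1] is flipped: moving [s1] to the side of [s], two points
   of the same half of [e] would be sent too far apart. *)
have [eq|ne2] := eqVneq s (l - s); first by rewrite E2 -eq.
have rev (t : R) : t%:E \in `]0%E, l%:E[ -> (l - t)%:E \in `]0%E, l%:E[.
  by rewrite !in_openE !lte_fin => /andP[? ?]; apply/andP; split; lra.
have ltof (t : R) : t%:E \in `]0%E, l%:E[ -> 0 < t < l.
  by rewrite in_openE lte_fin.
have [s2 [hs2 F2 side]] : exists s2 : R, [/\ s2%:E \in `]0%E, l%:E[,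
    h (ept e s2%:E) = ept e' (l - s2)%:E
    & (s2 < l / 2) && (s < l / 2) || (l / 2 < s2) && (l / 2 < s)].
  (* The mirror image of [s1] is flipped too; otherwise [h] would send two different points to the
     same one. *)
  have F1' : h (ept e (l - s1)%:E) = ept e' (l - (l - s1))%:E.
    have [E1'|//] := alt _ (rev _ hs1); move: E1'; rewrite -E1 => E1'.
    case: H => hg _ _ _ _; have := congr1 g E1'; rewrite !hg.
    move=> /ept_inj []; rewrite ?El ?rev // => _ [] /esym /eqP.
    by rewrite (negbTE ne1).
  case: (ltrgtP s (l / 2)) => hl; last by case/eqP: ne2; lra.
    case: (ltrgtP s1 (l / 2)) => hl1; last by case/eqP: ne1; lra.
      by exists s1; rewrite hl1.
    exists (l - s1); split=> //; first exact: rev.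
    by apply/orP; left; rewrite andbT; lra.
  case: (ltrgtP s1 (l / 2)) => hl1; last by case/eqP: ne1; lra.
    exists (l - s1); split=> //; first exact: rev.
    by apply/orP; right; rewrite andbT; lra.
  by exists s1; rewrite hl1 orbT.
have hse' : s%:E \in `]0%E, len e'[ by rewrite EL.
have hs2e' : (l - s2)%:E \in `[0%E, len e'] by rewrite EL; apply: open_closed; exact: rev.
(* Since [s] and [s2] lie strictly in the same half, both [|s - (l - s2)|] and the sum of the tents
   exceed [|s - s2|], contradicting the isometry. *)
have := dist_same_edge hse' hs2e'; rewrite -E2 -F2.
have hse : s%:E \in `[0%E, len e] by rewrite El; exact: open_closed.
have hs2e : s2%:E \in `[0%E, len e] by rewrite El; exact: open_closed.
have := dist_ept hse hs2e; case: H => _ _ _ -> _ le1 le2.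
have := le_trans le2 le1; rewrite seg_lengthE lee_fin /edge_tent EL /=.
have /andP[s0 sl] := ltof _ hs; have /andP[s20 s2l] := ltof _ hs2.
clear -side s0 sl s20 s2l => /= ctr; exfalso; move: ctr.
case/orP: side => /andP[? ?];
  case: (leP s (l - s)) => ?; case: (leP (l - s2) (l - (l - s2))) => ?;
  case: (ger0P (s - s2)) => ?; case: (ger0P (s - (l - s2))) => ?;
  match goal with |- context [Num.min ?a ?b] => case: (leP a b) => ? ? end; lra.
Qed.

End IsometryEdges.

(** * Extension to the ends of the edges, including the ends at infinity *)

Section IsometryEndpoints.
Context {R : realType} {X : topologicalType} {d : X -> X -> \bar R}.
Variable M : model d.

Lemma infinite_tail_inj (e e' : edge M) (t u : \bar R) : len e = +oo%E ->
  (0%E < u)%E -> t \in `[0%E, len e'] -> ept e' t = ept e u -> e' = e /\ t = u.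
Proof.
move=> El u0 ht E.
have [uy|uy] := eqVneq u +oo%E; last first.
  have hu : u \in `]0%E, len e[ by rewrite in_itv /= El u0 lt_neqAle uy leey.
  have [t0|tl|ho] := closed_cases ht.
  - by move: E; rewrite t0 ept0 => /esym /ept_vpt [].
  - by move: E; rewrite tl ept_len => /esym /ept_vpt [].
  exact: ept_inj E.
have E2 : ept e' t = vpt (ends e true) by rewrite E uy -El ept_len.
have [t0|tl|ho] := closed_cases ht; last by case: (ept_vpt ho E2).
  by move: E2; rewrite t0 ept0 => /vpt_inj /(leaf_unique El) [].
move: E2; rewrite {1}tl ept_len => /vpt_inj /(leaf_unique El) [e'e _].
by rewrite tl uy e'e.
Qed.

(** If a continuous map sent an infinite end into this set, it would send points far out on the edge
    there as well; this is how [isom_infinite_end] uses continuity. *)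
Lemma open_outside_tail (e : edge M) : len e = +oo%E ->
  open [set x : X | forall u, (1%:E <= u)%E -> x <> ept e u].
Proof.
move=> El; apply/(open_model M) => e'; apply/open_subspaceP.
exists (if e' == e then [set t | (t < 1%:E)%E] else setT).
  case: ifP => _; [exact: open_ereal_lt_ereal|exact: openT].
apply/seteqP; split=> t [h ht]; split=> //.
  move=> u u1 /= E; have [] := infinite_tail_inj El _ ht E.
    by apply: lt_le_trans u1; rewrite lte_fin.
  by move=> e'e tu; move: h; rewrite e'e eqxx /= tu ltNge u1.
case: eqP => // e'e /=; rewrite ltNge; apply/negP => t1.
by apply: (h t t1); rewrite e'e.
Qed.

(** The bump around [u] drops by at most [|a - t|] between the image of [t] and [w], so it is still
    positive at [w], and [u] is the only vertex where that can happen. The argument needs an end at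
    a finite parameter. *)
Lemma isom_end h g (e : edge M) (a t delta : R) (u w : vertex M) : vertex_isom M h g ->
  0 < delta -> (forall e : edge M, ((delta *+ 2)%:E <= len e)%E) ->
  a%:E \in `[0%E, len e] -> t%:E \in `[0%E, len e] -> h (ept e a%:E) = vpt w ->
  `|a - t| < vbump delta u (h (ept e t%:E)) -> w = u.
Proof.
move=> [_ _ _ hd _] d0 dP ha ht E lt_at; apply: (@vbump_vpt_gt0 _ _ _ M delta).
have := vbump_lipschitz d0 dP u (h (ept e t%:E)) (h (ept e a%:E)); rewrite hd.
move=> /le_trans /(_ (dist_ept ht ha)); rewrite seg_lengthE lee_fin -E distrC.
rewrite distrC in lt_at; move: lt_at; set A := vbump _ _ _; set B := vbump _ _ _.
by rewrite ler_distl => ? /andP[? ?]; lra.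
Qed.

Lemma vbump_near0 (delta : R) (e : edge M) (s : R) : 0 < delta ->
  (forall e : edge M, ((delta *+ 2)%:E <= len e)%E) ->
  s%:E \in `[0%E, len e] -> delta - s <= vbump delta (ends e false) (ept e s%:E).
Proof. by move=> d0 dP hs; rewrite vbump_ept //= eqxx !le_max lexx orbT. Qed.

Lemma vbump_near_len (delta l : R) (e : edge M) (s : R) : 0 < delta ->
  (forall e : edge M, ((delta *+ 2)%:E <= len e)%E) -> len e = l%:E ->
  s%:E \in `[0%E, len e] -> delta - (l - s) <= vbump delta (ends e true) (ept e s%:E).
Proof. by move=> d0 dP El hs; rewrite vbump_ept //= El eqxx !le_max lexx !orbT. Qed.

(* The metric does not see a point at infinity, so continuity is needed here. *)
Lemma isom_infinite_end h g (e e' : edge M) w : vertex_isom M h g ->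
  len e = +oo%E -> len e' = +oo%E ->
  (forall s : \bar R, s \in `]0%E, len e[ -> h (ept e s) = ept e' s) ->
  h (vpt (ends e true)) = vpt w -> w = ends e' true.
Proof.
move=> [_ _ [ch _] _ _] El El' hE hw; apply: contrapT => ne.
have /(open_model M) /(_ e) /open_subspaceP[V oV VE] :=
  (continuousP _).1 ch _ (open_outside_tail El').
have Vy : V +oo%E.
  suff : (V `&` `[0%E, len e]) +oo%E by case.
  rewrite VE /=; split; last by rewrite /= El in_itv /= lexx leey.
  move=> u u1; rewrite -{1}El ept_len hw => E.
  apply: ne; apply: (@vpt_inj _ _ _ M); rewrite E -ept_len El'.
  have [->//|uy] := eqVneq u +oo%E.
  case: (@ept_vpt _ _ _ M e' u w) => //.
  by rewrite in_itv /= El' (lt_le_trans _ u1) ?lte_fin //= lt_neqAle uy leey.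
have [A [Ar AV]] := open_nbhs_nbhs (conj oV Vy).
(* Beyond [A], so that [t] is in [V], and beyond 1, so that its image is in the excluded tail. *)
pose t := Num.max A 1 + 1.
have At : A < t by rewrite /t ltr_pwDr // le_max lexx.
have t1 : 1 <= t by rewrite /t ler_wpDr // le_max lexx orbT.
have ht : t%:E \in `]0%E, len e[ by rewrite El in_openE ltey andbT; lra.
have : (V `&` `[0%E, len e]) t%:E.
  by split; [apply: AV; rewrite lte_fin|exact: open_closed].
by rewrite VE => -[/(_ t%:E)]; rewrite lee_fin => /(_ t1); rewrite hE.
Qed.

Lemma isom_edge h g (e : edge M) : vertex_isom M h g -> exists2 e' : edge M, len e' = len e &
  (forall s : \bar R, s \in `[0%E, len e] -> h (ept e s) = ept e' s) \/
  exists2 l : R, len e = l%:E &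
    forall s : R, s%:E \in `[0%E, len e] -> h (ept e s%:E) = ept e' (l - s)%:E.
Proof.
move=> H; have [e' EL alt] := isom_edge_interior e H; exists e' => //.
have [delta d0 dP] := half_min_len M.
have [_ _ _ _ [hv _]] := H.
have [w0 hw0] := hv (ends e false); have [w1 hw1] := hv (ends e true).
have hE0 : h (ept e 0%:E) = vpt w0 by rewrite -[0%:E]/0%E ept0.
(* Any positive [t] below [delta / 2] would do: at distance [t] from an end the bump there is at
   least [delta - t], which must exceed [t] for [isom_end]. *)
pose t := delta / 4.
have t0 : 0 < t by rewrite /t divr_gt0.
have t4 : delta = t *+ 4 by rewrite /t -mulr_natr divfK.
have tl : (t%:E < len e)%E by apply: lt_le_trans (dP e); rewrite lte_fin t4; lra.
have ht : t%:E \in `]0%E, len e[ by rewrite in_openE t0.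
have [same|[l El flip]] := alt.
  left=> s /closed_cases[->|->|/same //].
    rewrite !ept0 hw0; congr vpt.
    apply: (isom_end H d0 dP (len_itv0 e) (open_closed ht) hE0).
    rewrite (same _ ht); apply: lt_le_trans (vbump_near0 d0 dP _).
      by rewrite sub0r normrN gtr0_norm // t4; lra.
    by rewrite EL open_closed.
  rewrite -{2}EL !ept_len hw1; congr vpt.
  have [El|[l El l0]] := len_fin_or_infty e.
    by apply: (isom_infinite_end H El (etrans EL El) same hw1).
  have hEl : h (ept e l%:E) = vpt w1 by rewrite -El ept_len.
  have hl : l%:E \in `[0%E, len e] by rewrite -El len_itvl.
  have hlt : (l - t)%:E \in `]0%E, len e[.
    by move: tl; rewrite El in_openE !lte_fin => tl; apply/andP; split; lra.
  apply: (isom_end H d0 dP hl (open_closed hlt) hEl).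
  rewrite (same _ hlt); apply: lt_le_trans (vbump_near_len d0 dP (etrans EL El) _).
    by rewrite !subKr gtr0_norm // t4; lra.
  by rewrite EL open_closed.
right; exists l => // s.
have hEl : h (ept e l%:E) = vpt w1 by rewrite -El ept_len.
have hl : l%:E \in `[0%E, len e] by rewrite -El len_itvl.
have hlt : (l - t)%:E \in `]0%E, len e[.
  by move: tl; rewrite El in_openE !lte_fin => tl; apply/andP; split; lra.
have El' := etrans EL El.
move=> /closed_cases[[->]|sE|/flip //].
  rewrite subr0 hE0 -El' ept_len; congr vpt.
  apply: (isom_end H d0 dP (len_itv0 e) (open_closed ht) hE0).
  rewrite (flip _ ht); apply: lt_le_trans (vbump_near_len d0 dP El' _).
    by rewrite sub0r normrN gtr0_norm // subKr t4; lra.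
  by rewrite EL open_closed.
have -> : s = l by move: sE; rewrite El => -[].
rewrite subrr hEl ept0; congr vpt.
apply: (isom_end H d0 dP hl (open_closed hlt) hEl).
rewrite (flip _ hlt) subKr; apply: lt_le_trans (vbump_near0 d0 dP _).
  by rewrite gtr0_norm // t4; lra.
by rewrite EL open_closed.
Qed.

End IsometryEndpoints.

(** * The action on vertices and edges *)

Section ActionOnType.
Context {K : finGroupType} {T : Type} (to : {action K &-> T}).

Let actP_total : is_action [set: K]%SET to.
Proof. by case: to. Qed.

Lemma to_mul x k1 k2 : to x (k1 * k2)%g = to (to x k1) k2.
Proof. by have [_ toM] := actP_total; apply: toM; rewrite finset.inE. Qed.

Lemma to_one x : to x 1%g = x.
Proof.
by have [toI _] := actP_total; apply: (toI 1%g); rewrite -to_mul mulg1.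
Qed.

Lemma to_invK k : cancel (to^~ k) (to^~ k^-1%g).
Proof. by move=> x; rewrite -to_mul mulgV to_one. Qed.

Lemma to_Kinv k : cancel (to^~ k^-1%g) (to^~ k).
Proof. by move=> x; rewrite -to_mul mulVg to_one. Qed.

End ActionOnType.

Section OrbitRepresentatives.
Context {K : finGroupType} {T : finType}.
Variable A : {action K &-> T}.

(** The choice made by [pick] depends only on the set picked from, so all points of an orbit get the
    same representative. *)
Definition orbit_rep (x : T) : T := odflt x [pick y in orbit A [set: K]%SET x].

Lemma orbit_rep_act x : exists k, A x k = orbit_rep x.
Proof.
rewrite /orbit_rep; case: pickP => [y /orbitP[k _ E]|_] /=; first by exists k.
by exists 1%g; rewrite act1.
Qed.

Lemma orbit_rep_eq x k : orbit_rep (A x k) = orbit_rep x.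
Proof.
rewrite /orbit_rep.
have E : orbit A [set: K]%SET (A x k) = orbit A [set: K]%SET x.
  by apply: (orbit_act A (G := [set: K]%G)); rewrite finset.inE.
rewrite E; case: pickP => //= /(_ x).
by rewrite orbit_refl.
Qed.

Lemma orbit_rep_idem x : orbit_rep (orbit_rep x) = orbit_rep x.
Proof. by have [k E] := orbit_rep_act x; rewrite -{1}E orbit_rep_eq. Qed.

Lemma orbit_rep_conj x y : orbit_rep x = orbit_rep y -> exists k, A x k = y.
Proof.
have [k1 E1] := orbit_rep_act x; have [k2 E2] := orbit_rep_act y => E.
by exists (k1 * k2^-1)%g; rewrite actM E1 E -E2 actK.
Qed.

End OrbitRepresentatives.

Section EdgeAction.
Context {R : realType} {X : topologicalType} {d : X -> X -> \bar R}.
Context {K : finGroupType} {to : {action K &-> X}}.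
Hypothesis hK : isometric_action d to.
Variable M : model d.

Definition vertex_invariant : Prop :=
  forall k (v : vertex M), exists w : vertex M, to (vpt v) k = vpt w.

Hypothesis hV : vertex_invariant.

Lemma act_vertex_isom k : vertex_isom M (to^~ k) (to^~ k^-1%g).
Proof.
split; [exact: to_invK|exact: to_Kinv| | |].
- by split; [exact: (hK k).1|exact: (hK k^-1%g).1].
- exact: (hK k).2.
- by split=> v; exact: hV.
Qed.

Definition vact_fun (v : vertex M) (k : K) : vertex M := projT1 (cid (hV k v)).

Lemma vpt_vact_fun v k : vpt (vact_fun v k) = to (vpt v) k.
Proof. by rewrite /vact_fun; case: cid. Qed.

Lemma vact_is_action : is_action [set: K]%SET vact_fun.
Proof.
apply: is_total_action => [v|v k1 k2]; apply: (@vpt_inj _ _ _ M).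
  by rewrite vpt_vact_fun to_one.
by rewrite !vpt_vact_fun to_mul.
Qed.

Definition vact : {action K &-> vertex M} := Action vact_is_action.

Lemma vpt_vact v k : vpt (vact v k) = to (vpt v) k.
Proof. exact: vpt_vact_fun. Qed.

Definition eact_fun (e : edge M) (k : K) : edge M :=
  projT1 (cid2 (isom_edge e (act_vertex_isom k))).

Lemma len_eact_fun e k : len (eact_fun e k) = len e.
Proof. by rewrite /eact_fun; case: cid2. Qed.

Lemma ept_eact_fun e k :
  (forall s : \bar R, s \in `[0%E, len e] -> to (ept e s) k = ept (eact_fun e k) s) \/
  exists2 l : R, len e = l%:E &
    forall s : R, s%:E \in `[0%E, len e] -> to (ept e s%:E) k = ept (eact_fun e k) (l - s)%:E.
Proof. by rewrite /eact_fun; case: cid2. Qed.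

Lemma ept_eact_fun_open e k (s : \bar R) : s \in `]0%E, len e[ ->
  exists2 s' : \bar R, s' \in `]0%E, len e[ & to (ept e s) k = ept (eact_fun e k) s'.
Proof.
move=> hs; have [E|[l El E]] := ept_eact_fun e k.
  by exists s => //; rewrite E // open_closed.
have [r er _] := in_openP hs; rewrite er in hs *; exists (l - r)%:E; last first.
  by apply: E; exact: open_closed.
move: hs; rewrite El !in_openE !lte_fin => /andP[? ?]; apply/andP; split; lra.
Qed.

Lemma open_nonempty (e : edge M) : exists s : \bar R, s \in `]0%E, len e[.
Proof.
have [->|[l -> l0]] := len_fin_or_infty e.
  by exists 1%:E; rewrite in_openE ltr01 ltey.
by exists (l / 2)%:E; rewrite in_openE lte_fin; apply/andP; split; lra.
Qed.

(** The image edge was obtained by choice; one interior point already determines it, and the action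
    laws follow from this. *)
Lemma eact_fun_uniq e e' k (s s' : \bar R) : s \in `]0%E, len e[ -> s' \in `]0%E, len e'[ ->
  to (ept e s) k = ept e' s' -> eact_fun e k = e'.
Proof.
move=> hs hs' E; have [t ht E'] := ept_eact_fun_open k hs.
by move: E'; rewrite E => /ept_inj[] //; rewrite ?len_eact_fun.
Qed.

Lemma eact_is_action : is_action [set: K]%SET eact_fun.
Proof.
apply: is_total_action => [e|e k1 k2]; have [s hs] := open_nonempty e.
  by apply: (eact_fun_uniq hs hs); rewrite to_one.
have [s1 hs1 E1] := ept_eact_fun_open k1 hs.
have hs1' : s1 \in `]0%E, len (eact_fun e k1)[ by rewrite len_eact_fun.
have [s2 hs2 E2] := ept_eact_fun_open k2 hs1'.
apply: (eact_fun_uniq (s' := s2) hs); last by rewrite to_mul E1 E2.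
by rewrite len_eact_fun.
Qed.

Definition eact : {action K &-> edge M} := Action eact_is_action.

Lemma len_eact e k : len (eact e k) = len e.
Proof. exact: len_eact_fun. Qed.

Lemma eact_uniq e e' k (s s' : \bar R) : s \in `]0%E, len e[ -> s' \in `]0%E, len e'[ ->
  to (ept e s) k = ept e' s' -> eact e k = e'.
Proof. exact: eact_fun_uniq. Qed.

Lemma ept_eact_closed e k (s : \bar R) : s \in `[0%E, len e] ->
  exists2 s' : \bar R, s' \in `[0%E, len e] & to (ept e s) k = ept (eact e k) s'.
Proof.
move=> hs; have [E|[l El E]] := ept_eact_fun e k; first by exists s => //; rewrite E.
have [[_ Ey]|[r er _]] := in_segP hs; first by rewrite Ey in El.
rewrite er in hs *; exists (l - r)%:E; last exact: E.
move: hs; rewrite El !in_segE !lee_fin => /andP[? ?]; apply/andP; split; lra.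
Qed.

Lemma ept_eact_open e k (s : \bar R) : s \in `]0%E, len e[ ->
  exists2 s' : \bar R, s' \in `]0%E, len e[ & to (ept e s) k = ept (eact e k) s'.
Proof. exact: ept_eact_fun_open. Qed.

Lemma ept_eact e k :
  (forall s : \bar R, s \in `[0%E, len e] -> to (ept e s) k = ept (eact e k) s) \/
  exists2 l : R, len e = l%:E &
    forall s : R, s%:E \in `[0%E, len e] -> to (ept e s%:E) k = ept (eact e k) (l - s)%:E.
Proof. exact: ept_eact_fun. Qed.

(** The boolean [c] records whether [k] reverses the parameter. Reversals are possible for a general
    invariant model. *)
Lemma ends_eact e k : exists c : bool, forall b, vact (ends e b) k = ends (eact e k) (b (+) c).
Proof.
have [E|[l El E]] := ept_eact e k; [exists false|exists true] => b;
  apply: (@vpt_inj _ _ _ M); rewrite vpt_vact.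
  rewrite addbF; case: b; last by rewrite -!ept0 E // len_itv0.
  by rewrite -!ept_len E ?len_itvl // len_eact.
have El' : len (eact e k) = l%:E by rewrite len_eact.
case: b; first rewrite -ept_len El E ?subrr ?ept0 //; first by rewrite -El len_itvl.
rewrite -ept0 (E 0) ?subr0 -?El' ?ept_len //.
exact: len_itv0.
Qed.

End EdgeAction.

(** * Topology of models and of tropical projective space *)

Lemma sign_norm (R : realType) (x : R) : exists eps : int, (eps = 1 \/ eps = -1) /\
  x = `|x| * eps%:~R.
Proof.
have [x0|x0] := lerP 0 x.
  by exists 1; split; [left|rewrite mulr1 ?ger0_norm].
by exists (-1); split; [right|rewrite mulrN1 ?ltr0_norm ?opprK].
Qed.

(* [w j0] divides [c j0 * w k] for every [k], hence divides [c j0], because the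
   [w k] have no common factor. *)
Lemma primitive_ratio (R : realType) (n : nat) (w c : 'I_n -> int) (x lam : R) :
  0 < lam -> \big[gcdn/0%N]_(j < n) `|w j|%N = 1%N -> x != 0 ->
  (forall j, (c j)%:~R * x = lam * (w j)%:~R) -> `|x| <= lam.
Proof.
move=> lam0 gcd1 x0 cw.
have [j wj] : exists j, w j != 0.
  apply: contrapT => /forallNP w0; move: gcd1; rewrite big1 // => j _.
  by have /negP := w0 j; rewrite negbK => /eqP ->.
have cross k : c k * w j = c j * w k.
  apply/eqP; rewrite -(@eqr_int R) !intrM; apply/eqP.
  apply: (mulfI x0); apply: (mulfI (lt0r_neq0 lam0)).
  have := cw k; have := cw j; move=> E1 E2.
  transitivity (((c k)%:~R * x) * (lam * (w j)%:~R)); first by ring.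
  by rewrite E2 -E1; ring.
have dv : (`|w j| %| `|c j|)%N.
  rewrite -[X in (_ %| X)%N]muln1 -gcd1.
  rewrite (@big_morph _ _ (muln `|c j|%N) 0%N gcdn 0%N gcdn) ?muln0 //; last exact: muln_gcdr.
  by apply/dvdn_biggcdP => k _; rewrite -abszM -cross abszM dvdn_mull.
have cj : c j != 0.
  apply/eqP => c0; have := cw j; rewrite c0 mul0r => /esym/eqP.
  by rewrite mulf_eq0 intr_eq0 (negbTE wj) (gt_eqF lam0).
have le : (`|w j| <= `|c j|)%N by apply: dvdn_leq dv; rewrite absz_gt0.
have E : `|c j|%:~R * `|x| = lam * `|w j|%:~R :> R.
  by rewrite !intr_norm -normrM cw normrM (gtr0_norm lam0).
have c0 : 0 < `|c j|%:~R :> R by rewrite ltr0z normr_gt0.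
rewrite -(ler_pM2l c0) E mulrC ler_pM2r // ler_int.
by rewrite -!abszE lez_nat.
Qed.

Lemma affine_continuous (R : realType) (a b : R) :
  continuous (fun s : \bar R => (a%:E * s + b%:E)%E).
Proof.
move=> s; apply: cvgeD; [by rewrite fin_num_adde_defl|exact: mule_continuous|exact: cvg_cst].
Qed.

Lemma edge_linear_continuous (R : realType) (X : topologicalType) (d : X -> X -> \bar R)
    (M : model d) (g : X -> \bar R) :
  (forall e : edge M, linear_on_edge e g) -> continuous g.
Proof.
move=> gL; apply/continuousP => U oU; apply/(open_model M) => e.
have [a [b gE]] := gL e; apply/open_subspaceP.
exists ((fun s : \bar R => ((a%:~R : R)%:E * s + b%:E)%E) @^-1` U).
  by have /continuousP := @affine_continuous R a%:~R b; apply.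
by apply/seteqP; split=> s /= [h hs]; split=> //; move: h; rewrite /= gE.
Qed.

Lemma affine_inj (R : realType) (a : int) (b : R) (s t : \bar R) : a = 1 \/ a = -1 ->
  ((a%:~R : R)%:E * s + b%:E = (a%:~R : R)%:E * t + b%:E)%E -> s = t.
Proof.
move=> a1 E; have {E} : ((a%:~R : R)%:E * s = (a%:~R : R)%:E * t)%E.
  by move: E => /(congr1 (fun x => x - b%:E)%E); rewrite !addeK.
case: a1 => ->; first by rewrite !mul1e.
by rewrite mulrN1z !EFinN !mulN1e => /oppe_inj.
Qed.

Lemma prod_continuous (X : topologicalType) (I : Type) (T : topologicalType)
    (g : X -> prod_topology (fun _ : I => T)) :
  (forall i, continuous (fun x => g x i)) -> continuous g.
Proof.
move=> gC x; apply/cvg_sup => i.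
exact: (@continuous_comp_initial _ X T (fun h : I -> T => h i) g (gC i) x).
Qed.

Lemma prod_cvg (I : Type) (T : topologicalType) (J : Type) (F : set_system J) (FF : Filter F)
    (g : J -> prod_topology (fun _ : I => T)) (l : prod_topology (fun _ : I => T)) :
  (forall i, (fun x => g x i) @ F --> l i) -> g @ F --> l.
Proof.
move=> gC; apply/cvg_sup => i U [?/= [[W oW <-]]] /= Wl /filterS; apply; apply: (gC i).
exact: open_nbhs_nbhs.
Qed.

Lemma eval_continuous (I : eqType) (T : topologicalType) (i : I) :
  continuous (fun g : prod_topology (fun _ : I => T) => g i).
Proof. exact: (@proj_continuous I (fun=> T) i). Qed.

Lemma ereal_segment_compact (R : realType) (L : \bar R) :
  compact [set` `[0%E, L]].
Proof.
have finc (r : R) : compact [set` `[0%E, r%:E]].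
  have -> : [set` `[0%E, r%:E]] = (@EFin R) @` `[0, r]%classic.
    apply/seteqP; split=> [s|_ [t ht <-]] /=.
      move=> /in_segP[[_ //]|[t -> [t0 tr]]]; exists t => //=.
      by rewrite in_itv /= t0.
    by rewrite in_segE lee_fin; move: ht; rewrite /= in_itv.
  apply: continuous_compact; last exact: segment_compact.
  by apply: continuous_subspaceT => ? U /nbhs_EFin.
case: L => [r| |]; first exact: finc.
  (* Either the filter clusters at +oo, or some member of it misses a neighbourhood of +oo; in the
     second case the filter lives on a bounded segment, which is compact. *)
  move=> F FF Fs; have [cy|/existsNP[A /existsNP[B H]]] :=
    pselect (forall A B, F A -> nbhs +oo%E B -> A `&` B !=set0).
    by exists +oo%E; split=> //; rewrite /= in_itv /= lexx leey.
  move: H => /not_implyP[FA /not_implyP[[r [_ rB]] AB]].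
  have Fr : F [set` `[0%E, r%:E]].
    apply: filterS (filterI Fs FA) => s [hs As].
    move: hs; rewrite /= !in_itv /= => /andP[-> _]; rewrite leNgt; apply/negP => rs.
    by apply: AB; exists s; split=> //; exact: rB.
  have [s [hs cs]] := finc r F FF Fr; exists s; split=> //.
  by move: hs; rewrite /= !in_itv /= => /andP[-> _]; rewrite leey.
have -> : [set` `[0%E, (-oo : \bar R)%E]] = set0.
  by apply/seteqP; split=> s //=; rewrite in_itv /= leeNy_eq => /andP[h /eqP E]; rewrite E in h.
exact: compact0.
Qed.

Section ModelTopology.
Context {R : realType} {X : topologicalType} {d : X -> X -> \bar R} (M : model d).

Lemma ept_continuous (e : edge M) : {within [set` `[0%E, len e]], continuous (ept e)}.
Proof. by apply/continuousP => U /(open_model M). Qed.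

Lemma model_compact : compact [set: X].
Proof.
have -> : [set: X] = (\big[setU/set0]_(v : vertex M) [set vpt v]) `|`
    \big[setU/set0]_(e : edge M) (ept e @` [set` `[0%E, len e]]).
  apply/seteqP; split=> // x _; have [[v ->]|[e [s [hs ->]]]] := model_cover M x.
    by left; rewrite -bigcup_seq; exists v => //=; rewrite mem_index_enum.
  right; rewrite -bigcup_seq; exists e; first by rewrite /= mem_index_enum.
  by exists s => //=; exact: open_closed.
apply: compactU; apply: bigsetU_compact => i _; first exact: compact_set1.
by apply: continuous_compact; [exact: ept_continuous|exact: ereal_segment_compact].
Qed.

End ModelTopology.

Section TropicalNormalization.
Context {R : realType} {n : nat}.
Local Notation E := (prod_topology (fun _ : 'I_n => \bar R)).
Variables (i0 : 'I_n) (A : set E).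
Hypothesis oA : open A.

Lemma open_normalized :
  open [set t : E | t i0 \is a fin_num /\ A (fun j => t j - t i0)%E].
Proof.
rewrite openE => t [ti0 At]; apply: filterI.
  apply: (@eval_continuous _ (\bar R) i0 t [set s | s \is a fin_num]).
  case: (t i0) ti0 => // r _.
  by have : \forall y \near r%:E, y \is a fin_num by exists 1 => /=.
have nA : @nbhs E E (fun j => t j - t i0)%E A by exact: open_nbhs_nbhs.
have cg : (fun (u : E) => (fun j => u j - u i0)%E : E) @ nbhs (t : E)
    --> ((fun j => t j - t i0)%E : E).
  apply: prod_cvg => j.
  apply: cvgeB; [|exact: (@eval_continuous 'I_n (\bar R) j)
                 |exact: (@eval_continuous 'I_n (\bar R) i0)].
  by rewrite fin_num_adde_defl // fin_numN.
exact: (cg A nA).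
Qed.

(* The open set of [TP R n] cut out by [A] in the chart where the coordinate [i0] is [0]. *)
Definition trop_saturation : set (TP R n) :=
  [set u | exists t : @trop_vectors R n, u = (\pi_(TP R n) t)%qT /\
    (set_val t i0 \is a fin_num /\ A (fun j => set_val t j - set_val t i0)%E)].

Lemma open_trop_saturation : open trop_saturation.
Proof.
rewrite /open /= /quotient_open.
exists [set t : E | t i0 \is a fin_num /\ A (fun j => t j - t i0)%E]; first exact: open_normalized.
apply/seteqP; split=> t /=; first by move=> h; exists t.
move=> [t' [/eqmodP /asboolP[lam tt'] [fi At']]].
rewrite tt' fin_numD fi; split=> //.
suff -> : (fun j => set_val t j - (set_val t' i0 + lam%:E))%E =
  (fun j => set_val t' j - set_val t' i0)%E by [].
apply/funext => j; rewrite tt'.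
by rewrite fin_num_oppeD // addeACA -EFinN -EFinD subrr adde0.
Qed.

End TropicalNormalization.

(** * The quotient graph inside tropical projective space *)

Section Covering.
Context {R : realType} {X : topologicalType} {d : X -> X -> \bar R}.
Context {K : finGroupType} {to : {action K &-> X}}.
Variables (hK : isometric_action d to) (M : model d) (hV : vertex_invariant (to := to) M).
Variables (n : nat) (f : 'I_n -> X -> \bar R) (i0 i1 : 'I_n).
(** Normalises homogeneous coordinates: points with the same image under [phi] have equal
    coordinates, not merely equal up to a shift. *)
Hypothesis f0 : forall x, f i0 x = 0%E.
Hypothesis flin : forall i (e : edge M), linear_on_edge e (f i).
Hypothesis fny : forall i x, f i x <> +oo%E.
Hypothesis finv : forall i k x, f i (to x k) = f i x.
Hypothesis fsep : forall x y, (forall i, f i x = f i y) -> exists k, to x k = y.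
(** This coordinate is injective on each edge, so no element of [K] flips an edge; it makes the
    slope vectors primitive; and, together with [fny], it is -oo at the end of an infinite edge, as
    infinite lattice length requires. *)
Hypothesis fslope : forall e : edge M, exists (a : int) (b : R), (a = 1 \/ a = -1) /\
  forall s : \bar R, s \in `[0%E, len e] -> f i1 (ept e s) = ((a%:~R : R)%:E * s + b%:E)%E.

Lemma lift_subproof x : trop_vectors (fun i => f i x).
Proof. by split; [move=> i; exact: fny|exists i0; rewrite f0]. Qed.

Definition trop_lift (x : X) : @trop_vectors R n :=
  exist _ (fun i => f i x) (mem_set (lift_subproof x)).

Definition phi (x : X) : TP R n := (\pi_(TP R n) (trop_lift x))%qT.

Lemma trop_lift_continuous : continuous trop_lift.
Proof.
apply: (continuous_comp_initial (w := set_val)); apply: prod_continuous => i.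
exact: edge_linear_continuous (flin i).
Qed.

Lemma phi_continuous : continuous phi.
Proof.
by move=> x; apply: continuous_comp; [exact: trop_lift_continuous|exact: pi_continuous].
Qed.

Lemma trop_coords_phi x : trop_coords (phi x) (f^~ x).
Proof. by exists (trop_lift x). Qed.

Lemma trop_coords_uniq (u : TP R n) t t' : trop_coords u t -> trop_coords u t' ->
  exists lam : R, forall i, t i = (t' i + lam%:E)%E.
Proof.
by move=> [t1 [<- ->]] [t2 [<- /eqmodP /asboolP]].
Qed.

Lemma phi_coords x t : trop_coords (phi x) t -> exists lam : R, forall i, t i = (f i x + lam%:E)%E.
Proof. by move=> /trop_coords_uniq; apply; exact: trop_coords_phi. Qed.

Lemma phiP x y : phi x = phi y <-> exists k, to x k = y.
Proof.
split=> [E|[k <-]].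
  have [lam H] := phi_coords (eq_ind _ (fun u => trop_coords u (f^~ x)) (trop_coords_phi x) _ E).
  have lam0 : lam = 0 by have := H i0; rewrite !f0 add0e => -[].
  by apply: fsep => i; rewrite H lam0 adde0.
rewrite /phi; congr (\pi_(TP R n) _)%qT; apply: val_inj => /=.
by apply/funext => i; rewrite finv.
Qed.

Lemma f1_inj (e : edge M) (s t : \bar R) : s \in `[0%E, len e] -> t \in `[0%E, len e] ->
  f i1 (ept e s) = f i1 (ept e t) -> s = t.
Proof.
have [a [b [a1 fE]]] := fslope e => hs ht.
by rewrite !fE //; exact: affine_inj.
Qed.

Lemma f1_infinite (e : edge M) : len e = +oo%E -> f i1 (ept e +oo%E) = -oo%E.
Proof.
move=> El; have [a [b [a1 fE]]] := fslope e.
have := @fny i1 (ept e +oo%E); rewrite fE ?El ?in_itv //=; last by rewrite lexx leey.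
case: a1 => ->; first by rewrite mul1e.
by rewrite mulrN1z EFinN mulN1e.
Qed.

Local Notation va := (vact hV).
Local Notation ea := (eact hK hV).

(* No flip: [f i1] is invariant and injective on [e]. *)
Lemma eact_fix (e : edge M) k (s : \bar R) : ea e k = e -> s \in `[0%E, len e] ->
  to (ept e s) k = ept e s.
Proof.
move=> ke hs; have [s' hs' E] := ept_eact_closed hK hV k hs.
rewrite ke in E; rewrite E; congr ept; apply: (f1_inj (e := e)) => //.
by rewrite -E finv.
Qed.

(** The quotient graph is built on orbit representatives, whose lengths and parameters it inherits.
    An edge of [M] oriented against its representative is therefore mapped with slope -1. *)
Definition qvertex := {v : vertex M | orbit_rep va v == v}.
Definition qedge := {e : edge M | orbit_rep ea e == e}.

Definition mk_qvertex (v : vertex M) : qvertex :=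
  exist _ (orbit_rep va v) (introT eqP (orbit_rep_idem va v)).
Definition mk_qedge (e : edge M) : qedge :=
  exist _ (orbit_rep ea e) (introT eqP (orbit_rep_idem ea e)).

Lemma mk_qvertexK (v : qvertex) : mk_qvertex (val v) = v.
Proof. by apply: val_inj; case: v => v /= /eqP. Qed.

Lemma mk_qedgeK (e : qedge) : mk_qedge (val e) = e.
Proof. by apply: val_inj; case: e => e /= /eqP. Qed.

Lemma mk_qvertex_act v k : mk_qvertex (va v k) = mk_qvertex v.
Proof. by apply: val_inj; rewrite /= orbit_rep_eq. Qed.

Lemma mk_qedge_act e k : mk_qedge (ea e k) = mk_qedge e.
Proof. by apply: val_inj; rewrite /= orbit_rep_eq. Qed.

Definition qends (e : qedge) (b : bool) : qvertex := mk_qvertex (ends (val e) b).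
Definition qlen (e : qedge) : \bar R := len (val e).

Lemma qends_mk (e : edge M) : exists c : bool, forall b,
  mk_qvertex (ends e b) = qends (mk_qedge e) (b (+) c).
Proof.
have [k kE] := orbit_rep_act ea e; have [c cE] := ends_eact hK hV e k.
by exists c => b; rewrite /qends /= -kE -cE mk_qvertex_act.
Qed.

Lemma qgraph_nonempty : (0 < #|{: qvertex}|)%N.
Proof.
have /card_gt0P[v _] := vertex_nonempty M.
by apply/card_gt0P; exists (mk_qvertex v).
Qed.

Lemma qgraph_connected (u v : qvertex) :
  connect (fun u v => [exists e : qedge, exists b, (qends e b == u) && (qends e (~~ b) == v)]) u v.
Proof.
rewrite -(mk_qvertexK u) -(mk_qvertexK v).
have /connectP[p pP ->] := wgraph_connected (val u) (val v).
elim: p (val u) pP => [|z p IH] a /=; first by rewrite connect0.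
move=> /andP[/existsP[e /existsP[b /andP[/eqP <- /eqP <-]]] /IH]; apply: connect_trans.
have [c cE] := qends_mk e; apply: connect1; apply/existsP; exists (mk_qedge e).
by apply/existsP; exists (b (+) c); rewrite !cE addNb !eqxx.
Qed.

Lemma qlen_gt0 e : (0 < qlen e)%E.
Proof. exact: len_gt0. Qed.

Lemma mk_qedge_inj (e e' : qedge) k : ea (val e) k = val e' -> e = e'.
Proof. by move=> E; rewrite -(mk_qedgeK e') -E mk_qedge_act mk_qedgeK. Qed.

(** A half-edge at the same quotient vertex is moved by some [k] onto the only half-edge of [M] at
    the leaf. Both edges are representatives, hence equal, and [k] fixes this edge pointwise by
    [eact_fix], so the sides agree as well. *)
Lemma qlen_infty (e : qedge) : qlen e = +oo%E ->
  #|[pred h : qedge * bool | qends h.1 h.2 == qends e true]| = 1%N.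
Proof.
move=> El; apply: (@fintype.eq_card1 _ (e, true)) => -[e' b]; rewrite !inE /=.
apply/eqP/eqP; last by case=> -> ->.
move=> /(congr1 val) /= /orbit_rep_conj[k].
have [c cE] := ends_eact hK hV (val e') k; rewrite cE => /(leaf_unique El)[ke bc].
have ee := mk_qedge_inj ke; rewrite -{}ee in El ke *.
have := eact_fix ke (len_itvl (val e')); have := eact_fix ke (len_itv0 (val e')).
rewrite ept0 ept_len -!(vpt_vact hV) !cE ke => /vpt_inj h0 /vpt_inj h1.
have [_ cf] := leaf_unique El h1; have c0 : c = false by case: (c) cf.
by move: bc; rewrite c0 addbF => ->.
Qed.

Definition qgraph : wgraph R := @WGraph R qvertex qedge qends qlen
  qgraph_nonempty qgraph_connected qlen_gt0 qlen_infty.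

Local Notation Y := (range phi).
Local Notation dY := (image_dist d f phi).

Definition toY : X -> Y := to_image phi.

Lemma toYP x y : toY x = toY y <-> exists k, to x k = y.
Proof.
rewrite -phiP; split=> [/(congr1 set_val) //|E]; exact: val_inj.
Qed.

Lemma toY_surj (y : Y) : exists x, toY x = y.
Proof.
by case: y => u hu; have [x _ E] := set_mem hu; exists x; apply: val_inj.
Qed.

Lemma toY_act x k : toY (to x k) = toY x.
Proof. by apply/esym/toYP; exists k. Qed.

Lemma toY_continuous : continuous toY.
Proof.
exact: (continuous_comp_initial (w := set_val) (f := toY)) phi_continuous.
Qed.

Definition qvpt (v : qvertex) : Y := toY (vpt (val v)).
Definition qept (e : qedge) (s : \bar R) : Y := toY (ept (val e) s).

Lemma toY_vpt v : toY (vpt v) = qvpt (mk_qvertex v).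
Proof.
have [k kE] := orbit_rep_act va v.
by rewrite /qvpt /= -kE vpt_vact toY_act.
Qed.

Lemma len_mk_qedge (e : edge M) : qlen (mk_qedge e) = len e.
Proof. by have [k kE] := orbit_rep_act ea e; rewrite /qlen /= -kE len_eact. Qed.

Lemma toY_ept (e : edge M) :
  (forall s : \bar R, s \in `[0%E, len e] -> toY (ept e s) = qept (mk_qedge e) s) \/
  exists2 l : R, len e = l%:E &
    forall s : R, s%:E \in `[0%E, len e] -> toY (ept e s%:E) = qept (mk_qedge e) (l - s)%:E.
Proof.
have [k kE] := orbit_rep_act ea e.
have [E|[l El E]] := ept_eact hK hV e k; [left=> s hs|right; exists l => // s hs].
  by rewrite /qept /= -kE -E // toY_act.
by rewrite /qept /= -kE -E // toY_act.
Qed.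

Lemma qept0 (e : qedge) : qept e 0%E = qvpt (qends e false).
Proof. by rewrite /qept ept0 toY_vpt. Qed.

Lemma qept_len (e : qedge) : qept e (qlen e) = qvpt (qends e true).
Proof. by rewrite /qept ept_len toY_vpt. Qed.

Lemma qvpt_inj : injective qvpt.
Proof.
move=> v w /toYP[k]; rewrite -(vpt_vact hV) => /vpt_inj kE.
by rewrite -(mk_qvertexK w) -kE mk_qvertex_act mk_qvertexK.
Qed.

Lemma qept_inj (e e' : qedge) (s s' : \bar R) : s \in `]0%E, qlen e[ -> s' \in `]0%E, qlen e'[ ->
  qept e s = qept e' s' -> e = e' /\ s = s'.
Proof.
move=> hs hs' /toYP[k E].
have ee := mk_qedge_inj (eact_uniq hK hV hs hs' E); split=> //.
rewrite -ee in hs' E; apply: (f1_inj (open_closed hs) (open_closed hs')).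
by rewrite -E finv.
Qed.

Lemma qept_vpt (e : qedge) (s : \bar R) v : s \in `]0%E, qlen e[ -> qept e s <> qvpt v.
Proof.
move=> hs /toYP[k]; have [s' hs' ->] := ept_eact_open hK hV k hs.
by apply: ept_vpt; rewrite len_eact.
Qed.

Lemma qcover (y : Y) : (exists v, y = qvpt v) \/
  (exists (e : qedge) (s : \bar R), (s \in `]0%E, qlen e[) /\ y = qept e s).
Proof.
have [x <-] := toY_surj y; have [[v ->]|[e [s [hs ->]]]] := model_cover M x.
  by left; exists (mk_qvertex v); exact: toY_vpt.
right; exists (mk_qedge e); have [E|[l El E]] := toY_ept e.
  by exists s; rewrite len_mk_qedge E // open_closed.
have [r er _] := in_openP hs; rewrite er in hs *.
exists (l - r)%:E; rewrite len_mk_qedge E ?open_closed //; split=> //.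
by move: hs; rewrite El !in_openE !lte_fin => /andP[? ?]; apply/andP; split; lra.
Qed.

(* [X] is compact, so the complement of the preimage of [U] has a closed image in the
   chart [i0] of [TP R n]. *)
Lemma toY_open (U : set Y) : open (toY @^-1` U) -> open U.
Proof.
move=> oW; pose F (x : X) : prod_topology (fun _ : 'I_n => \bar R) := f^~ x.
have cF : continuous F by apply: prod_continuous => i; exact: edge_linear_continuous (flin i).
pose C := ~` (toY @^-1` U).
have cC : closed (F @` C).
  apply: compact_closed.
    by apply: (@hausdorff_product 'I_n (fun=> \bar R)) => _; exact: ereal_hausdorff.
  apply: continuous_compact; first exact: continuous_subspaceT.
  by apply: subclosed_compact (model_compact M) _ => //; exact: open_closedC.
have oA : open (~` (F @` C)) by exact: closed_openC.
exists (trop_saturation i0 (~` (F @` C))); first exact: open_trop_saturation.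
apply/seteqP; split=> y; have [x <-] := toY_surj y => /=.
  move=> [t [E [tfin At]]]; apply: contrapT => nU; apply: At.
  have [lam tE] := phi_coords (ex_intro _ t (conj erefl E)).
  exists x; first exact: nU.
  apply/funext => j; rewrite /F !tE f0 add0e addeK //.
have vE : set_val (trop_lift x) = F x by [].
move=> Ux; exists (trop_lift x); split=> //; rewrite vE {1}/F f0; split=> //.
move=> [c nUc] Fc; apply: nUc; rewrite /=.
suff -> : toY c = toY x by [].
apply/toYP; apply: fsep => i; have := congr1 (fun g => g i) Fc.
by rewrite /F /= f0 sube0.
Qed.

Lemma qopen (U : set Y) : open U <->
  forall e : qedge, open (qept e @^-1` U : set (subspace [set` `[0%E, qlen e]])).
Proof.
split=> [oU e|H].
  have /(open_model M) /(_ (val e)) // : open (toY @^-1` U).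
  by have /continuousP := toY_continuous; apply.
apply: toY_open; apply/(open_model M) => e.
have /open_subspaceP[V oV VE] := H (mk_qedge e); rewrite len_mk_qedge in VE.
apply/open_subspaceP; have [E|[l El E]] := toY_ept e.
  exists V => //; rewrite VE.
  by apply/seteqP; split=> s /= [h hs]; split=> //; move: h; rewrite /= E.
exists ((fun s : \bar R => ((-1)%:E * s + l%:E)%E) @^-1` V).
  by have /continuousP := @affine_continuous R (-1) l; apply.
have hflip (r : R) : r%:E \in `[0%E, len e] -> (l - r)%:E \in `[0%E, len e].
  by rewrite El !in_segE !lee_fin => /andP[? ?]; apply/andP; split; lra.
have flipE (r : R) : ((-1)%:E * r%:E + l%:E)%E = (l - r)%:E.
  by rewrite -EFinM -EFinD mulN1r addrC.
move/seteqP: VE => [VE1 VE2]; apply/seteqP; split=> s [h hs]; split=> //=;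
  (have [[_ Ey]|[r er _]] := in_segP hs; first by rewrite Ey in El);
  rewrite er in h hs *.
  move: h; rewrite /= flipE E // => h.
  by have [] := VE1 _ (conj h (hflip _ hs)).
move: h; rewrite /= flipE E // => h.
by have [] := VE2 _ (conj h (hflip _ hs)).
Qed.

(** * Lattice length and the quotient metric *)

Definition qstep := edge_step (G := qgraph) qept.

Lemma qstep_ge0 : nonneg_step qstep.
Proof. by move=> x y a [e [s [t [_ _ _ _ ->]]]]; exact: seg_length_ge0. Qed.

Lemma image_step_ge0 : nonneg_step (image_step d f phi).
Proof.
move=> x y a [N [e [s [t [_ _ _ _]]]]].
by case=> [[_ ->]|[_ [_ [_ [lam [_ [_ _ [lam0 _] _ ->]]]]]]|[_ _ ->]] //; rewrite lee_fin ltW.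
Qed.

(** The differences of coordinates are the integer slopes times the difference of parameters. The
    slopes are coprime because one of them is 1 or -1, and relative to the constant coordinate [i0]
    they are not altered. *)
Lemma lattice_length_edge (e : edge M) (s t : \bar R) :
  s \in `[0%E, len e] -> t \in `[0%E, len e] ->
  lattice_length (phi (ept e s)) (phi (ept e t)) (seg_length s t).
Proof.
move=> hs ht; have [st|st] := eqVneq s t.
  by rewrite st seg_length_eq; constructor 1.
have ne : phi (ept e s) <> phi (ept e t).
  move=> /phiP[k E]; case/eqP: st; apply: (f1_inj hs ht).
  by rewrite -E finv.
have inf1 x : x = ept e +oo%E -> len e = +oo%E ->
    exists i, exists2 t, trop_coords (phi x) t & t i = -oo%E.
  move=> -> El; exists i1, (f^~ (ept e +oo%E)); first exact: trop_coords_phi.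
  exact: f1_infinite.
have [[sy El]|[r sE [r0 rl]]] := in_segP hs.
  constructor 3; split=> //; first by left; apply: inf1; rewrite ?sy.
  by rewrite sy seg_length_pinftyl // -sy eq_sym.
have [[ty El]|[r' tE [r0' rl']]] := in_segP ht.
  constructor 3; split=> //; first by right; apply: inf1; rewrite ?ty.
  by rewrite ty seg_length_pinftyr // -ty.
constructor 2; rewrite sE tE in st hs ht ne *.
have [a aE] := choice (fun j => flin j e); have [b {aE}abE] := choice aE.
have fE j (u : R) : u%:E \in `[0%E, len e] -> f j (ept e u%:E) = ((a j)%:~R * u + b j)%:E.
  by move=> hu; rewrite abE.
have rr : r != r' by [].
(* The slopes in [a] were chosen from [flin]; evaluation at the two distinct parameters identifies
   them with those known from [f0] and [fslope]. *)
have a0 : a i0 = 0.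
  have := fE i0 _ hs; have := fE i0 _ ht; rewrite !f0 => -[E1] [E2].
  have : (a i0)%:~R * (r - r') = 0 by rewrite mulrBr; lra.
  by move=> /eqP; rewrite mulf_eq0 subr_eq0 (negbTE rr) orbF intr_eq0 => /eqP.
have a1 : `|a i1|%N = 1%N.
  have [a' [b' [a1' fE']]] := fslope e.
  have := fE i1 _ hs; have := fE i1 _ ht; rewrite !fE' // -!EFinM -!EFinD => -[E1] [E2].
  have : (a' - a i1)%:~R * (r - r') = 0 by rewrite intrB mulrBl !mulrBr; lra.
  move=> /eqP; rewrite mulf_eq0 [X in _ || X]subr_eq0 (negbTE rr) orbF intr_eq0 subr_eq0.
  by move=> /eqP <-; case: a1' => ->.
have co (u : R) : u%:E \in `[0%E, len e] ->
    trop_coords (phi (ept e u%:E)) (fun j => ((a j)%:~R * u + b j)%:E).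
  move=> hu; have <- : (fun j => f j (ept e u%:E)) = (fun j => ((a j)%:~R * u + b j)%:E).
    by apply/funext => j; exact: fE.
  exact: trop_coords_phi.
have [eps [epsE rE]] := sign_norm (r - r').
(* Lattice length asks for a positive factor, so the sign [eps] of [r - r'] is moved into the
   integer vector. *)
exists (fun j => (a j)%:~R * r + b j), (fun j => (a j)%:~R * r' + b j), i0, `|r - r'|,
  (fun j => a j * eps).
split=> //.
- by split; exact: co.
- split; first by rewrite normr_gt0 subr_eq0.
  apply/eqP; rewrite -dvdn1.
  have -> : 1%N = absz (a i1 * eps) by rewrite abszM a1; case: epsE => ->.
  by apply: (@biggcdn_inf _ i1 xpredT (fun j => absz (a j * eps))); rewrite ?dvdnn.
- move=> j; rewrite a0 intrM mulr0z !mul0r.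
  transitivity ((a j)%:~R * (r - r')); first by ring.
  by rewrite {1}rE; ring.
- by rewrite seg_lengthE.
Qed.

Lemma qdist_le_dist x y : (path_dist qstep (toY x) (toY y) <= d x y)%E.
Proof.
rewrite (dist_model M); apply: (path_dist_le (h := toY)); first exact: qstep_ge0.
move=> {x y} x y a [e [s [t [hs ht -> -> ->]]]]; apply: path_dist_step.
have [E|[l El E]] := toY_ept e.
  exists (mk_qedge e), s, t; rewrite /= len_mk_qedge hs ht !E //.
have [[_ Ey]|[r er _]] := in_segP hs; first by rewrite Ey in El.
have [[_ Ey]|[r' er' _]] := in_segP ht; first by rewrite Ey in El.
rewrite er er' in hs ht *; exists (mk_qedge e), (l - r)%:E, (l - r')%:E.
rewrite /= len_mk_qedge -!E //; split=> //.
- by move: hs; rewrite El !in_segE !lee_fin => /andP[? ?]; apply/andP; split; lra.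
- by move: ht; rewrite El !in_segE !lee_fin => /andP[? ?]; apply/andP; split; lra.
- by rewrite !seg_lengthE distrC; congr (`|_|%:E); ring.
Qed.

(** The model [N] is unrelated to [M], so no slope is known to be 1 or -1. It is enough that the
    slope differences are integers: by [primitive_ratio] the lattice length is at least the length
    in [X], which dominates the quotient distance. *)
Lemma qdist_le_lattice (N : model d) (e : edge N) (s t a : \bar R) :
  (forall i, linear_on_edge e (f i)) -> s \in `[0%E, len e] -> t \in `[0%E, len e] ->
  lattice_length (phi (ept e s)) (phi (ept e t)) a ->
  (path_dist qstep (toY (ept e s)) (toY (ept e t)) <= a)%E.
Proof.
move=> fl hs ht [[E ->]|[x [y [i [lam [w [ne [cx cy] [lam0 gcd1] xy ->]]]]]]|[_ _ ->]].
- by rewrite (_ : toY (ept e s) = toY (ept e t)) ?(path_distxx qstep_ge0) //; apply: val_inj.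
- have [c cE] := choice (fun j => fl j); have [b {cE}fE] := choice cE.
  have [mu xE] := phi_coords cx; have [nu yE] := phi_coords cy.
  have fin_slope (u : \bar R) (z : 'I_n -> R) (k : R) : u \in `[0%E, len e] ->
      (forall j, (z j)%:E = (f j (ept e u) + k%:E)%E) -> u = +oo%E -> forall j, c j = 0.
    move=> hu zE uy j; have := zE j; rewrite fE // uy.
    have [|c0|] := ltgtP (c j) 0; last by [].
      by move=> c0; rewrite lt0_muley ?lte_fin ?ltrz0.
    by rewrite gt0_muley ?lte_fin ?ltr0z.
  (* If one of the two points is at infinity on [e] and still has real coordinates,
     then all the [f j] are constant on [e]. *)
  have const : (forall j, c j = 0) -> False.
    move=> c0; apply: ne; rewrite /phi; congr (\pi_(TP R n) _)%qT; apply: val_inj.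
    by apply/funext => j; rewrite /= !fE // c0 !mul0e.
  have [[sy _]|[r sE _]] := in_segP hs; first by case: (const (fin_slope _ _ _ hs xE sy)).
  have [[ty _]|[r' tE _]] := in_segP ht; first by case: (const (fin_slope _ _ _ ht yE ty)).
  rewrite sE tE in hs ht ne xE yE *.
  apply: le_trans (qdist_le_dist _ _) _; apply: le_trans (dist_ept hs ht) _.
  rewrite seg_lengthE lee_fin.
  have xE' j : x j = (c j)%:~R * r + b j + mu by have := xE j; rewrite fE // => -[].
  have yE' j : y j = (c j)%:~R * r' + b j + nu by have := yE j; rewrite fE // => -[].
  apply: (@primitive_ratio _ _ w (fun j => c j - c i)) => //.
    by rewrite subr_eq0; apply/eqP => E; apply: ne; rewrite E.
  by move=> j; rewrite -xy !xE' !yE' intrB; ring.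
- by rewrite leey.
Qed.

Lemma qdist x y : dY x y = path_dist qstep x y.
Proof.
apply/eqP; rewrite eq_le; apply/andP; split.
  apply: (path_dist_le (h := id)); first exact: image_step_ge0.
  move=> {x y} x y a [e [s [t [hs ht -> -> ->]]]]; apply: path_dist_step.
  exists M, (val e), s, t; split=> //.
  exact: (lattice_length_edge hs ht).
apply: (path_dist_le (h := id)); first exact: qstep_ge0.
move=> {x y} x y a [N [e [s [t [fl hs ht [-> ->] L]]]]].
exact: (qdist_le_lattice fl hs ht L).
Qed.

Definition qmodel : model dY := @Model R Y dY qgraph qvpt qept
  qept0 qept_len qvpt_inj qept_inj qept_vpt qcover qopen qdist.

(** * The projection as a morphism of models *)

Lemma f1_toY x y : toY x = toY y -> f i1 x = f i1 y.
Proof. by move=> /toYP[k <-]; rewrite finv. Qed.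

Lemma qept_closed_inj (e : qedge) (s t : \bar R) : s \in `[0%E, qlen e] -> t \in `[0%E, qlen e] ->
  qept e s = qept e t -> s = t.
Proof. by move=> hs ht /f1_toY; exact: f1_inj. Qed.

Lemma slope_ex (e : edge M) : exists a : int,
  (a = 1 /\ forall s : \bar R, s \in `[0%E, len e] -> toY (ept e s) = qept (mk_qedge e) s) \/
  (a = -1 /\ exists2 l : R, len e = l%:E &
    forall s : R, s%:E \in `[0%E, len e] -> toY (ept e s%:E) = qept (mk_qedge e) (l - s)%:E).
Proof. by have [H|H] := toY_ept e; [exists 1; left|exists (-1); right]. Qed.

Definition slope (e : edge M) : int := projT1 (cid (slope_ex e)).

Lemma slopeP (e : edge M) :
  (slope e = 1 /\ forall s : \bar R, s \in `[0%E, len e] -> toY (ept e s) = qept (mk_qedge e) s) \/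
  (slope e = -1 /\ exists2 l : R, len e = l%:E &
    forall s : R, s%:E \in `[0%E, len e] -> toY (ept e s%:E) = qept (mk_qedge e) (l - s)%:E).
Proof. by rewrite /slope; case: cid. Qed.

Lemma toY_ept_open (e : edge M) (s : \bar R) : s \in `]0%E, len e[ ->
  exists2 s' : \bar R, s' \in `]0%E, len e[ & toY (ept e s) = qept (mk_qedge e) s'.
Proof.
move=> hs; have [E|[l El E]] := toY_ept e; first by exists s => //; rewrite E // open_closed.
have [r er _] := in_openP hs; rewrite er in hs *.
exists (l - r)%:E; last by rewrite E // open_closed.
by move: hs; rewrite El !in_openE !lte_fin => /andP[? ?]; apply/andP; split; lra.
Qed.

Lemma qmorphism_vertex (v : vertex M) : exists v' : vertex qmodel, toY (vpt v) = vpt v'.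
Proof. by exists (mk_qvertex v); exact: toY_vpt. Qed.

Lemma qmorphism_preimage (e' : edge qmodel) : exists A : set (edge M),
  toY @^-1` edge_interior e' = \bigcup_(e in A) edge_interior e.
Proof.
exists [set e | mk_qedge e = e']; apply/seteqP; split=> x /=.
  move=> [s hs /toYP[k E]]; exists (ea (val e') k).
    by rewrite /= mk_qedge_act mk_qedgeK.
  by have [s' hs' E'] := ept_eact_open hK hV k hs; exists s'; rewrite /= ?len_eact // -E'.
move=> [e <- [s hs <-]]; have [s' hs' E] := toY_ept_open hs.
rewrite /edge_interior (_ : len (mk_qedge e : edge qmodel) = len e); last exact: len_mk_qedge.
by exists s'.
Qed.

Lemma qmorphism_edge (e : edge M) : slope e <> 0 /\
  exists c : R, forall s : \bar R, s \in `[0%E, len e] ->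
    ((slope e)%:~R%:E * s + c%:E)%E \in `[0%E, len (mk_qedge e : edge qmodel)] /\
    toY (ept e s) = ept (mk_qedge e : edge qmodel) ((slope e)%:~R%:E * s + c%:E)%E.
Proof.
have lE : len (mk_qedge e : edge qmodel) = len e by exact: len_mk_qedge.
have [[-> E]|[-> [l El E]]] := slopeP e; split=> //.
  by exists 0 => s hs; rewrite mul1e adde0 lE; split=> //; exact: E.
exists l => s hs; have [[_ Ey]|[r er _]] := in_segP hs; first by rewrite Ey in El.
rewrite er in hs *.
have -> : ((-1)%:~R%:E * r%:E + l%:E)%E = (l - r)%:E by rewrite mulrN1z -EFinM -EFinD mulN1r addrC.
split; last exact: E.
by move: hs; rewrite lE El !in_segE !lee_fin => /andP[? ?]; apply/andP; split; lra.
Qed.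

Definition qmorphism : mg_morphism M qmodel (to_image phi) :=
  @Defs.Morphism R X Y d dY M qmodel (to_image phi) (fun e => Some (mk_qedge e)) slope
    toY_continuous qmorphism_vertex qmorphism_preimage qmorphism_edge.

Lemma edge_deg_qmorphism e : edge_deg qmorphism e = 1%N.
Proof. by rewrite /edge_deg /=; have [[-> _]|[-> _]] := slopeP e. Qed.

Lemma edge_not_loop (e : edge M) : toY (ept e 0%E) <> toY (ept e (len e)).
Proof.
move=> /f1_toY /f1_inj; rewrite len_itv0 len_itvl => /(_ isT isT) E.
by have := len_gt0 e; rewrite -E ltxx.
Qed.

Lemma model_loopless : loopless M.
Proof. by move=> e E; apply: (@edge_not_loop e); rewrite ept0 ept_len E. Qed.

Lemma qmodel_loopless : loopless qmodel.
Proof.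
move=> e E; apply: (@edge_not_loop (val e)).
rewrite -[LHS]/(qept e 0%E) -[RHS]/(qept e (qlen e)) qept0 qept_len.
exact: (congr1 qvpt E).
Qed.

(** The two ends of an edge have different images, so a one-point image leaves no edges, and
    connectedness leaves one vertex. *)
Lemma singleton_image : is_singleton Y -> is_singleton X.
Proof.
move=> [y yP]; have noedge (e : edge M) : False.
  by apply: (@edge_not_loop e); rewrite (yP (toY _)) (yP (toY (ept e (len e)))).
have /card_gt0P[v _] := vertex_nonempty M; exists (vpt v) => x.
have [[w ->]|[e]] := model_cover M x; last by case: (noedge e).
have /connectP[[|z p] /= + ->] := wgraph_connected w v => //.
by move=> /andP[/existsP[e]]; case: (noedge e).
Qed.

(** * Stabilisers and the degree *)

Definition stabiliser (x : X) : {set K} := [set k | to x k == x]%SET.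

Lemma stabiliser_group_set x : group_set (stabiliser x).
Proof.
apply/group_setP; split=> [|k1 k2]; rewrite !finset.inE ?to_one //.
by move=> /eqP E1 /eqP E2; rewrite to_mul E1 E2.
Qed.

Canonical stabiliser_group x := Group (stabiliser_group_set x).

(* With multiplicity 1 on [M], the degree forces the order of the edge stabiliser on
   the quotient. *)
Definition qmult (e : qedge) : nat := #|'C_([set: K])[val e | ea]|%g.

(** An element fixing [e] fixes its point [x], since there are no flips; so the stabiliser of [e] in
    [K] lies in that of [x], and orbit-stabiliser applies there. Its order is constant along the
    orbit of [e], hence may be computed at the representative. *)
Lemma card_edge_stabiliser (x : X) (e : edge M) (s : \bar R) : s \in `[0%E, len e] -> x = ept e s ->
  (#|orbit ea (stabiliser x) e| * qmult (mk_qedge e))%N = #|stabiliser x|.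
Proof.
move=> hs xE; rewrite -(card_orbit_stab ea (stabiliser_group x) e); congr muln.
have -> : 'C_(stabiliser_group x)[e | ea]%g = 'C_([set: K])[e | ea]%g.
  apply/setP => k; apply/setIP/setIP => -[_ Ck]; split=> //.
  by rewrite finset.inE xE eact_fix // ?eqxx //; exact/astab1P.
have [k kE] := orbit_rep_act ea e.
have := card_orbit_stab ea [set: K]%G (orbit_rep ea e).
rewrite -(card_orbit_stab ea [set: K]%G e) -kE orbit_act ?finset.inE //.
rewrite /qmult /= -kE; move/eqP; rewrite eqn_pmul2l; first by move/eqP.
by apply/card_gt0P; exists e; exact: orbit_refl.
Qed.

(** By injectivity of [f i1] along edges, the parameter of [x] on [e] is that of its image, or the
    reflected one if [slope e] is -1. So [x] avoids the end towards which the lifted germ points. *)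
Lemma half_edge_lift (x : X) (e : edge M) (b : bool) :
  half_edge (toY x) (mk_qedge e : edge qmodel, b) ->
  (exists2 s : \bar R, s \in `[0%E, len e] & x = ept e s) ->
  half_edge x (e, b (+) (slope e < 0)).
Proof.
have lE : len (mk_qedge e : edge qmodel) = len e by exact: len_mk_qedge.
move=> /asboolP[s [/= hs xs]] [t ht xt]; apply/asboolP; exists t; split=> //=.
have {}hs : if b then s \in `[0%E, len e[ else s \in `]0%E, len e] by rewrite -lE.
have hsc : s \in `[0%E, len e].
  by case: b hs; rewrite !in_itv /= => /andP[h1 h2]; rewrite ?h1 ?h2 ltW.
have [[sl E]|[sl [l El E]]] := slopeP e; rewrite sl.
  have -> : t = s.
    apply: (@qept_closed_inj (mk_qedge e)); rewrite ?len_mk_qedge //.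
    by rewrite -E // -xt.
  by case: b hs.
have [[_ Ey]|[r er _]] := in_segP ht; first by rewrite Ey in El.
rewrite er in ht xt *.
have sE : s = (l - r)%:E.
  have hlr : (l - r)%:E \in `[0%E, len e].
    by move: ht; rewrite El !in_segE !lee_fin => /andP[? ?]; apply/andP; split; lra.
  apply: (@qept_closed_inj (mk_qedge e)); rewrite ?len_mk_qedge //.
  by rewrite -E // -xt.
move: hs; rewrite sE El; case: b; rewrite !in_itv /= !lee_fin !lte_fin => /andP[? ?];
  by apply/andP; split; lra.
Qed.

(** If [k] carries [e] to [e'] and both contain [x], then [x] and its translate lie on [e'] with the
    same value of [f i1], so [k] fixes [x]. *)
Lemma orbit_edge (x : X) (e e' : edge M) (s : \bar R) : s \in `[0%E, len e] -> x = ept e s ->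
  (e' \in orbit ea (stabiliser x) e) <->
  mk_qedge e' = mk_qedge e /\ exists2 s' : \bar R, s' \in `[0%E, len e'] & x = ept e' s'.
Proof.
move=> hs xE; split.
  move=> /orbitP[k]; rewrite finset.inE => /eqP kx <-; split; first exact: mk_qedge_act.
  have [s' hs' E] := ept_eact_closed hK hV k hs.
  by exists s'; rewrite ?len_eact // -E -xE.
move=> [/(congr1 val) /= /esym /orbit_rep_conj[k kE] [s' hs' xE']].
have [t ht E] := ept_eact_closed hK hV k hs; rewrite kE in E.
have le' : len e' = len e by rewrite -kE len_eact.
apply/orbitP; exists k => //; rewrite finset.inE; apply/eqP.
rewrite xE E -xE xE'; congr ept.
apply: (f1_inj (e := e')); rewrite ?le' // -?le' //.
by rewrite -E finv -xE -xE'.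
Qed.

(** The half-edges of [x] over a given one correspond to a single orbit of edges under the
    stabiliser of [x], and each contributes [qmult]; by [card_edge_stabiliser] the total does not
    depend on the half-edge below. *)
Lemma qlocal_degree (x : X) :
  local_degree qmorphism (fun=> 1%N) qmult x #|stabiliser x|.
Proof.
move=> [e' b'] /[dup] hh' /asboolP[s [/= hs xs]].
have hsc : s \in `[0%E, len (val e')].
  by case: (b') hs; rewrite !in_itv /= => /andP[h1 h2]; rewrite ?h1 ?h2 ltW.
have [k kE] := (toYP _ _).1 (esym xs : toY (ept (val e') s) = toY x).
have [s1 hs1 E1] := ept_eact_closed hK hV k hsc.
pose e1 := ea (val e') k.
have x1 : x = ept e1 s1 by rewrite -kE E1.
have hs1' : s1 \in `[0%E, len e1] by rewrite len_eact.
have e1E : mk_qedge e1 = e' by rewrite mk_qedge_act mk_qedgeK.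
rewrite -(card_edge_stabiliser hs1' x1) e1E.
(* On each edge, the one direction that is mapped to [b']. *)
pose h (e : edge M) : edge M * bool := (e, b' (+) (slope e < 0)).
have hinj : injective h by move=> u v [].
rewrite -(card_imset _ hinj) -sum_nat_const /half_edge_degree.
apply: eq_big => [[e b]|[e b]].
  apply/andP/imsetP => [[/asboolP[t [/= ht xt]] /eqP[ee be]]
                       |[e2 /(orbit_edge _ hs1' x1)[ee ex] [-> ->]]].
    exists e; last by rewrite /h -be addbK.
    apply/(orbit_edge _ hs1' x1); rewrite ee e1E; split=> //; exists t => //.
    by case: (b) ht; rewrite !in_itv /= => /andP[h1 h2]; rewrite ?h1 ?h2 ltW.
  rewrite e1E in ee; split; last by rewrite /half_edge_img /= ee addbK.
  by apply: half_edge_lift => //; rewrite ee.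
move=> /andP[_ /eqP]; rewrite /half_edge_img /= => -[ee _].
by rewrite /mult_img edge_deg_qmorphism /= ee divn1 muln1.
Qed.

(** Pairs of a fibre point [x] and an element [k] carrying [x0] to [x] are counted twice: for fixed
    [x] these elements form a translate of the stabiliser of [x], and each [k] occurs for exactly
    one [x]. *)
Lemma sum_stabilisers (y : Y) :
  (\sum_(x \in toY @^-1` [set y]) #|stabiliser x|)%R = #|K|.
Proof.
have [x0 x0y] := toY_surj y.
pose orb := undup [seq to x0 k | k <- enum K].
have -> : toY @^-1` [set y] = [set` orb].
  apply/seteqP; split=> x /=.
    rewrite -x0y => /esym/toYP[k <-]; rewrite mem_undup.
    by apply/mapP; exists k; rewrite ?mem_enum.
  by rewrite mem_undup => /mapP[k _ ->]; rewrite toY_act.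
rewrite -fsbig_seq ?undup_uniq //.
have stabE x : x \in orb -> #|stabiliser x| = (\sum_(k : K) (to x0 k == x))%N.
  rewrite mem_undup => /mapP[k0 _ ->].
  transitivity #|[set k | to x0 k == to x0 k0]%SET|; last first.
    rewrite -sum1_card big_mkcond /=; apply: eq_bigr => k _.
    by rewrite finset.inE; case: eqP.
  rewrite -(card_imset _ (mulgI k0)); congr #|pred_of_set _|; apply/setP => k.
  rewrite [RHS]finset.inE; apply/imsetP/eqP => [[k1 + ->]|E].
    by rewrite finset.inE => /eqP; rewrite to_mul.
  exists (k0^-1 * k)%g; last by rewrite mulKVg.
  by rewrite finset.inE -to_mul mulKVg E.
transitivity (\sum_(x <- orb) \sum_(k : K) (to x0 k == x))%N.
  by rewrite -[LHS]/(\sum_(x <- orb) #|stabiliser x|)%N; apply: eq_big_seq.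
rewrite exchange_big /= -sum1_card; apply: eq_bigr => k _.
have -> : (\sum_(x <- orb) (to x0 k == x))%N = count_mem (to x0 k) orb.
  by rewrite -sum1_count [RHS]big_mkcond /=; apply: eq_bigr => x _; rewrite eq_sym; case: eqP.
rewrite count_uniq_mem ?undup_uniq // mem_undup.
by rewrite (map_f (to x0)) // mem_enum.
Qed.

Lemma galois_covering_phi : exists (M' : model dY) (F : mg_morphism M M' (to_image phi))
  (m : edge M -> nat) (m' : edge M' -> nat), galois_covering to F m m'.
Proof.
exists qmodel, qmorphism, (fun=> 1%N), qmult; split.
- split=> //; [exact: model_loopless|exact: qmodel_loopless|].
  by move=> e; rewrite /qmult cardG_gt0.
- split; first by move=> e; rewrite edge_deg_qmorphism.
  rewrite /harmonic_of_degree; case: asboolP => [/singleton_image|_]; first by left.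
  split=> [e|]; first exact: dvd1n.
  by exists (fun x => #|stabiliser x|); [exact: qlocal_degree|exact: sum_stabilisers].
- by move=> k x; apply/esym/toYP; exists k.
- by move=> x y /toYP.
- by [].
Qed.

End Covering.

(** * Separating invariant functions *)

Section RefinedEdges.
Context {R : realType} {X : topologicalType} {d : X -> X -> \bar R}.

Lemma affine_on_refinement (M M' : model d) (e : edge M) (e' : edge M') (c : R) (g : X -> \bar R)
    (a : int) (b : R) :
  0 <= c -> (len e' + c%:E <= len e)%E ->
  (forall s : \bar R, s \in `[0%E, len e'] -> ept e' s = ept e (s + c%:E)%E) ->
  (forall s : \bar R, s \in `[0%E, len e] -> g (ept e s) = ((a%:~R : R)%:E * s + b%:E)%E) ->
  forall s : \bar R, s \in `[0%E, len e'] ->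
    g (ept e' s) = ((a%:~R : R)%:E * s + (a%:~R * c + b)%:E)%E.
Proof.
move=> c0 cl E gE s hs; rewrite E // gE; last first.
  move: hs; rewrite !in_itv /= => /andP[s0 sl].
  by rewrite adde_ge0 //= (le_trans _ cl) // leeD2r.
by rewrite muleDr ?fin_num_adde_defl // -addeA -EFinM -EFinD.
Qed.

(** Interior points of an edge are not vertices. Hence a break point of a function that has been
    made a vertex of [M'] leaves each edge of [M'] on one side. *)
Lemma refined_edge_avoids (M M' : model d) (e : edge M) (e' : edge M') (c u : R) :
  (forall s : \bar R, s \in `[0%E, len e'] -> ept e' s = ept e (s + c%:E)%E) ->
  is_vertex M' (ept e u%:E) -> u <= c \/ (len e' + c%:E <= u%:E)%E.
Proof.
move=> E [v vE]; have [uc|cu] := leP u c; first by left.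
right; rewrite leNgt; apply/negP => ul.
have hs : (u - c)%:E \in `]0%E, len e'[.
  by rewrite in_openE subr_gt0 cu EFinB lteBlDr.
apply: (ept_vpt hs (v := v)); rewrite E ?open_closed // -vE.
by rewrite -EFinD subrK.
Qed.

(** A real-valued variant that is stable under sums over [K]. Slope 0 on infinite edges is what
    reconciles [fine +oo = 0] with the value at the end. *)
Definition real_linear_on_edge (M : model d) (e : edge M) (g : X -> R) : Prop :=
  exists (a : int) (b : R), (len e = +oo%E -> a = 0) /\
    forall s : \bar R, s \in `[0%E, len e] -> g (ept e s) = a%:~R * fine s + b.

Lemma real_linear_linear (M : model d) (e : edge M) (g : X -> R) :
  real_linear_on_edge e g -> linear_on_edge e (fun x => (g x)%:E).
Proof.
move=> [a [b [a0 gE]]]; exists a, b => s hs; rewrite gE //.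
have [[sy El]|[r -> _]] := in_segP hs; last by rewrite /= EFinD EFinM.
by rewrite sy a0 // !mul0e mul0r add0e add0r.
Qed.

Lemma real_linear_sum (M : model d) (e : edge M) (I : finType) (g : I -> X -> R) :
  (forall i, real_linear_on_edge e (g i)) -> real_linear_on_edge e (fun x => \sum_i g i x).
Proof.
move=> /choice[a] /choice[b ab]; exists (\sum_i a i), (\sum_i b i); split=> [El|s hs].
  by apply: big1 => i _; exact: (ab i).1.
rewrite (eq_bigr (fun i => (a i)%:~R * fine s + b i)); last by move=> i _; exact: (ab i).2.
by rewrite big_split /= -mulr_suml -rmorph_sum.
Qed.

Lemma real_linear_act (K : finGroupType) (to : {action K &-> X}) (hK : isometric_action d to)
    (M : model d) (hV : vertex_invariant (to := to) M) (g : X -> R) (k : K) :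
  (forall e : edge M, real_linear_on_edge e g) ->
  forall e : edge M, real_linear_on_edge e (fun x => g (to x k)).
Proof.
move=> gL e; have [a [b [a0 gE]]] := gL (eact hK hV e k); rewrite len_eact in a0 gE.
have [E|[l El E]] := ept_eact hK hV e k.
  by exists a, b; split=> // s hs; rewrite E // gE.
exists (- a), (a%:~R * l + b); split=> [Ey|s hs]; first by rewrite Ey in El.
have [[_ Ey]|[r er _]] := in_segP hs; first by rewrite Ey in El.
rewrite er in hs *; rewrite E // gE /=; first by rewrite intrN; ring.
by move: hs; rewrite El !in_segE !lee_fin => /andP[? ?]; apply/andP; split; lra.
Qed.

End RefinedEdges.

Section EdgeBump.
Context {R : realType} {X : topologicalType} {d : X -> X -> \bar R}.
Variables (M : model d) (delta : R).
Hypotheses (d0 : 0 < delta) (dP : forall e : edge M, ((delta *+ 2)%:E <= len e)%E).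
Variable e0 : edge M.

(** Cutting the tent off at [delta] makes it constant far out on an infinite edge, with [delta] as
    its limit at infinity. *)
Definition ebump_edge (e : edge M) (t : \bar R) : R :=
  if e == e0 then if t is r%:E then Num.min delta (edge_tent e r%:E) else delta else 0.

(* Unlike [vdist], [ebump] is positive at the leaf at infinity of [e0], if any. *)
Definition ebump : X -> R := edge_glue ebump_edge (fun v =>
  if (len e0 == +oo%E) && (v == ends e0 true) then delta else 0).

Lemma ebump_ept (e : edge M) (t : \bar R) : t \in `[0%E, len e] -> ebump (ept e t) = ebump_edge e t.
Proof.
move=> ht; rewrite /ebump edge_glue_ept // => {ht t}{}e.
  have -> : ebump_edge e 0%E = 0.
    by rewrite /ebump_edge /= (edge_tent0 e : edge_tent e 0%:E = 0) min_r ?if_same // ltW.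
  by case: eqP => //= El; case: eqP => // /(leaf_unique El)[].
have [El|ne] := eqVneq (len e0) +oo%E.
  rewrite /ebump_edge; have [->|ne] := eqVneq e e0; first by rewrite El eqxx.
  by case: eqP => // /(leaf_unique El)[E]; rewrite E eqxx in ne.
rewrite /ebump_edge /=; case: eqP => // ee; rewrite -ee in ne.
have [El|[l El l0]] := len_fin_or_infty e; first by rewrite El in ne.
by rewrite El -El edge_tent_len min_r // ltW.
Qed.

Lemma ebump_ge0 x : 0 <= ebump x.
Proof.
have [[v ->]|[e [s [hs ->]]]] := model_cover M x.
  by rewrite /ebump edge_glue_vpt; case: ifP => // _; exact: ltW.
have [r sE _] := in_openP hs; rewrite sE in hs *.
rewrite ebump_ept ?open_closed // /ebump_edge; case: ifP => // _.
by rewrite le_min ltW //= edge_tent_ge0 // open_closed.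
Qed.

Lemma ebump_gt0 (s : \bar R) : (s \in `]0%E, len e0[) \/ (s = +oo%E /\ len e0 = +oo%E) ->
  0 < ebump (ept e0 s).
Proof.
move=> [hs|[-> El]].
  rewrite ebump_ept ?open_closed // /ebump_edge eqxx.
  have [r sE _] := in_openP hs; rewrite sE in hs *.
  by rewrite lt_min d0 edge_tent_gt0.
by rewrite ebump_ept ?El ?in_itv /= ?lexx ?leey // /ebump_edge eqxx.
Qed.

Lemma ebump_supp x : 0 < ebump x -> exists2 s : \bar R, s \in `[0%E, len e0] & x = ept e0 s.
Proof.
have [[v ->]|[e [s [hs ->]]]] := model_cover M x.
  rewrite /ebump edge_glue_vpt; case: ifP => [/andP[_ /eqP ->] _|]; last by rewrite ltxx.
  by exists (len e0); rewrite ?len_itvl // ept_len.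
rewrite ebump_ept ?open_closed // /ebump_edge; case: eqP => [<- _|]; last by rewrite ltxx.
by exists s => //; exact: open_closed.
Qed.

Lemma vbump_ge0 (u : vertex M) x : 0 <= vbump delta u x.
Proof.
have [[v ->]|[e [s [hs ->]]]] := model_cover M x.
  by rewrite /vbump edge_glue_vpt; case: ifP => // _; exact: ltW.
rewrite vbump_ept ?open_closed // /vbump_edge.
have [r -> _] := in_openP hs; rewrite le_max; apply/orP; left.
by case: ifP => // _; rewrite le_max lexx.
Qed.

End EdgeBump.

(** * Invariant refinements *)

Section InvariantModels.
Context {R : realType} {X : topologicalType} {d : X -> X -> \bar R}.
Context {K : finGroupType} {to : {action K &-> X}}.
Hypothesis hK : isometric_action d to.
Implicit Types M : model d.

Lemma vertex_invariantP M :
  vertex_invariant (to := to) M <-> forall k x, is_vertex M x -> is_vertex M (to x k).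
Proof.
split=> [H k x [v ->]|H k v]; first exact: H.
by apply: H; exists v.
Qed.

Lemma invariant_refine_points M (ps : seq X) :
  (forall k x, is_vertex M x \/ x \in ps -> is_vertex M (to x k) \/ to x k \in ps) ->
  exists M', [/\ refines M' M, vertex_invariant (to := to) M'
    & forall x, is_vertex M' x <-> is_vertex M x \/ x \in ps].
Proof.
move=> H; have [M' r vE] := refine_points M ps; exists M'; split=> //.
by apply/vertex_invariantP => k x /vE /(H k) /vE.
Qed.

Lemma invariant_model M0 : exists M : model d, vertex_invariant (to := to) M.
Proof.
pose ps := [seq to (vpt v) k | v <- enum (vertex M0), k <- enum K].
have psP (v : vertex M0) k : to (vpt v) k \in ps.
  by apply/allpairsP; exists (v, k); rewrite /= !mem_enum.
have [|M [_ H _]] := @invariant_refine_points M0 ps; last by exists M.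
move=> k x [[v ->]|/allpairsP[[v k'] /= [_ _ ->]]]; right; first exact: psP.
by rewrite -to_mul; exact: psP.
Qed.

Lemma midpoint_model M : vertex_invariant (to := to) M ->
  exists N : model d, [/\ refines N M, vertex_invariant (to := to) N
    & forall (e : edge M) (l : R), len e = l%:E -> is_vertex N (ept e (l / 2)%:E)].
Proof.
(* On an infinite edge [fine] gives 0, and the added point is [ept e 0], already a vertex. *)
move=> hV; pose mid (e : edge M) := ept e (fine (len e) / 2)%:E.
have [|N [r H vE]] := @invariant_refine_points M [seq mid e | e <- enum (edge M)]; last first.
  exists N; split=> // e l El; apply/vE; right.
  apply/mapP; exists e; first by rewrite mem_enum.
  by rewrite /mid El.
move=> k x [[v ->]|/mapP[e _ ->]]; first by left; exact: hV.
right; apply/mapP; exists (eact hK hV e k); first by rewrite mem_enum.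
rewrite /mid len_eact; have hm : (fine (len e) / 2)%:E \in `[0%E, len e].
  have [->|[l -> l0]] := len_fin_or_infty e; first by rewrite /= mul0r in_segE lexx leey.
  by rewrite in_segE lee_fin /=; apply/andP; split; lra.
have [E|[l El E]] := ept_eact hK hV e k; rewrite E //.
by congr (ept _ _%:E); rewrite El /=; lra.
Qed.

(** The new vertices are the points inside an edge where the bumps of width [delta] break. A
    reflection of an edge exchanges its two cuts, so the set is invariant. *)
Lemma collar_model M (delta : R) : vertex_invariant (to := to) M -> 0 < delta ->
  (forall e : edge M, ((delta *+ 2)%:E <= len e)%E) ->
  exists N : model d, [/\ refines N M, vertex_invariant (to := to) N
    & forall e : edge M, is_vertex N (ept e delta%:E) /\
        forall l : R, len e = l%:E -> is_vertex N (ept e (l - delta)%:E)].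
Proof.
move=> hV d0 dP.
pose cut (e : edge M) (b : bool) : X :=
  if b then if len e is l%:E then ept e (l - delta)%:E else ept e delta%:E else ept e delta%:E.
pose ps := [seq cut e b | e <- enum (edge M), b <- [:: true; false]].
have psP e b : cut e b \in ps by apply/allpairsP; exists (e, b); rewrite /= mem_enum !inE; case: b.
have [|N [r H vE]] := @invariant_refine_points M ps; last first.
  exists N; split=> // e; split=> [|l El]; apply/vE; right; first exact: (psP e false).
  by have := psP e true; rewrite /cut El.
move=> k x [[v ->]|/allpairsP[[e b] /= [_ _ ->]]]; first by left; exact: hV.
have hd : delta%:E \in `[0%E, len e].
  by rewrite in_segE ltW //= (le_trans _ (dP e)) // lee_fin mulr2n; lra.
right; have [El|[l El l0]] := len_fin_or_infty e.
  have -> : cut e b = ept e delta%:E by rewrite /cut El if_same.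
  have [E|[l' El' _]] := ept_eact hK hV e k; last by rewrite El' in El.
  by rewrite E //; exact: (psP _ false).
have hd' : (l - delta)%:E \in `[0%E, len e].
  by move: hd; rewrite El !in_segE !lee_fin => /andP[? ?]; apply/andP; split; lra.
have El' : len (eact hK hV e k) = l%:E by rewrite len_eact.
have [E|[l' E' E]] := ept_eact hK hV e k.
  have -> : to (cut e b) k = cut (eact hK hV e k) b; last exact: psP.
  by rewrite /cut El El'; case: b; rewrite E.
have -> : to (cut e b) k = cut (eact hK hV e k) (~~ b); last exact: psP.
have ll : l' = l by move: E'; rewrite El => -[].
by rewrite /cut El El'; case: b; rewrite E // ll ?subKr.
Qed.

End InvariantModels.

Section SignedVertexDistance.
Context {R : realType} {X : topologicalType} {d : X -> X -> \bar R}.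
Context {K : finGroupType} {to : {action K &-> X}}.
Variables (hK : isometric_action d to) (M : model d) (hV : vertex_invariant (to := to) M).

Definition leaf_at_infinity (x : X) : Prop := exists2 e : edge M, len e = +oo%E & x = ept e +oo%E.

Lemma leaf_at_infinity_act x k : leaf_at_infinity x -> leaf_at_infinity (to x k).
Proof.
move=> [e El ->]; exists (eact hK hV e k); first by rewrite len_eact.
have [E|[l El' _]] := ept_eact hK hV e k; last by rewrite El' in El.
by rewrite E // El in_itv /= lexx leey.
Qed.

Lemma leaf_at_infinity_ept (e : edge M) (r : R) : r%:E \in `[0%E, len e] ->
  ~ leaf_at_infinity (ept e r%:E).
Proof. by move=> hr [e' El /(infinite_tail_inj El)[]] //; rewrite lte_fin. Qed.

(** [vdist] is 0 at a leaf at infinity by convention, so the limit is put in by hand; the minus sign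
    makes it -oo, a legal tropical coordinate. *)
Definition opp_vdist (x : X) : \bar R :=
  if `[< leaf_at_infinity x >] then -oo%E else (- vdist M x)%:E.

Lemma opp_vdist_ny x : opp_vdist x <> +oo%E.
Proof. by rewrite /opp_vdist; case: ifP. Qed.

Lemma opp_vdist_act x k : opp_vdist (to x k) = opp_vdist x.
Proof.
rewrite /opp_vdist (vdist_isom (act_vertex_isom hK hV k)).
suff -> : `[< leaf_at_infinity (to x k) >] = `[< leaf_at_infinity x >] by [].
apply: asbool_equiv_eq; split; last exact: leaf_at_infinity_act.
by move=> /(@leaf_at_infinity_act _ k^-1%g); rewrite -to_mul mulgV to_one.
Qed.

Lemma opp_vdist_ept (e : edge M) (r : R) : r%:E \in `[0%E, len e] ->
  opp_vdist (ept e r%:E) = (- edge_tent e r%:E)%:E.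
Proof.
move=> hr; rewrite /opp_vdist asboolF ?vdist_ept //.
exact: leaf_at_infinity_ept.
Qed.

(** Inside an edge of [M] the function breaks only at the midpoint, and an edge of [N] lies on one
    side of it: slope -1 before, slope 1 after. On an infinite edge the slope is -1 throughout. *)
Lemma opp_vdist_slope (N : model d) : refines N M ->
  (forall (e : edge M) (l : R), len e = l%:E -> is_vertex N (ept e (l / 2)%:E)) ->
  forall e : edge N, exists (a : int) (b : R), (a = 1 \/ a = -1) /\
    forall s : \bar R, s \in `[0%E, len e] -> opp_vdist (ept e s) = ((a%:~R : R)%:E * s + b%:E)%E.
Proof.
move=> rNM mid e; have [e1 [c [c0 cl E]]] := rNM e.
have cin (r : R) : r%:E \in `[0%E, len e] -> (r + c)%:E \in `[0%E, len e1].
  rewrite !in_segE => /andP[r0 rl]; rewrite addr_ge0 //=.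
  by apply: le_trans cl; rewrite EFinD leeD2r.
have [El1|[l El1 l0]] := len_fin_or_infty e1.
  exists (-1), (- c); split=> [|s hs]; first by right.
  have [[sy El]|[r sE _]] := in_segP hs.
    rewrite E // sy addye // /opp_vdist asboolT; last by exists e1.
    by rewrite mulrN1z EFinN mulN1e.
  rewrite sE in hs *; rewrite E // -EFinD opp_vdist_ept ?cin // /edge_tent El1 /=.
  by rewrite mulrN1z -EFinM -EFinD; congr _%:E; ring.
have sfin (s : \bar R) : s \in `[0%E, len e] -> exists2 r : R, s = r%:E &
    [/\ r%:E \in `[0%E, len e], 0 <= r & r + c <= l].
  move=> hs; have [[sy El]|[r sE [r0 rl]]] := in_segP hs.
    by move: cl; rewrite El El1 addye.
  exists r => //; rewrite -sE; split=> //; rewrite sE in hs.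
  by have := cin _ hs; rewrite El1 in_segE lee_fin => /andP[].
have [hc|hc] := refined_edge_avoids E (mid e1 l El1).
  exists 1, (c - l); split=> [|s /sfin[r -> [hr r0 rl]]]; first by left.
  rewrite E // -EFinD opp_vdist_ept ?cin // /edge_tent El1 /= mul1e -EFinD.
  by rewrite min_r; [congr _%:E; ring|lra].
exists (-1), (- c); split=> [|s /sfin[r -> [hr r0 rl]]]; first by right.
rewrite E // -EFinD opp_vdist_ept ?cin // /edge_tent El1 /=.
have rc : r + c <= l / 2.
  rewrite -lee_fin; apply: le_trans hc; rewrite EFinD leeD2r //.
  by move: hr; rewrite in_segE => /andP[].
by rewrite mulrN1z -EFinM -EFinD min_l; [congr _%:E; ring|lra].
Qed.

End SignedVertexDistance.

Section BumpLinear.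
Context {R : realType} {X : topologicalType} {d : X -> X -> \bar R}.
Variables (M N : model d) (delta : R).
Hypotheses (d0 : 0 < delta) (dP : forall e : edge M, ((delta *+ 2)%:E <= len e)%E).
Hypotheses (rNM : refines N M) (collar : forall e : edge M, is_vertex N (ept e delta%:E) /\
  forall l : R, len e = l%:E -> is_vertex N (ept e (l - delta)%:E)).

(* The hypotheses are the three parts of an edge of [M] cut at distance [delta] from
   its ends; an edge of [N] lies in one of them. *)
Lemma collar_edge (g : X -> R) (p : edge M -> \bar R -> R) (e : edge N) :
  (forall (e : edge M) (s : \bar R), s \in `[0%E, len e] -> g (ept e s) = p e s) ->
  (forall e : edge M, exists (a : int) (b : R), forall u : R, 0 <= u -> u <= delta ->
    p e u%:E = a%:~R * u + b) ->
  (forall (e : edge M) (l : R), len e = l%:E -> exists (a : int) (b : R), forall u : R,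
    l - delta <= u -> u <= l -> p e u%:E = a%:~R * u + b) ->
  (forall e : edge M, exists b : R, forall s : \bar R, s \in `[0%E, len e] -> (delta%:E <= s)%E ->
    (forall l : R, len e = l%:E -> (s <= (l - delta)%:E)%E) -> p e s = b) ->
  real_linear_on_edge e g.
Proof.
move=> gE near far middle; have [e1 [c [c0 cl E]]] := rNM e.
have [v1 v2] := collar e1.
have cin (s : \bar R) : s \in `[0%E, len e] -> (s + c%:E)%E \in `[0%E, len e1].
  rewrite !in_itv /= => /andP[s0 sl].
  by rewrite adde_ge0 //= (le_trans _ cl) // leeD2r.
have le_len (s : \bar R) : s \in `[0%E, len e] -> (s + c%:E <= len e + c%:E)%E.
  by rewrite in_itv /= => /andP[_ sl]; rewrite leeD2r.
have affine (a : int) (b : R) (F : forall s : \bar R, s \in `[0%E, len e] ->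
    exists2 r : R, s = r%:E & p e1 (r + c)%:E = a%:~R * (r + c) + b) : real_linear_on_edge e g.
  exists a, (a%:~R * c + b); split=> [El|s hs].
    have hy : +oo%E \in `[0%E, len e] by rewrite El in_itv /= lexx leey.
    by case: (F _ hy).
  have [r sE pE] := F s hs; rewrite E // gE ?cin // sE -EFinD pE /=; ring.
have [hc|hc] := refined_edge_avoids E v1; last first.
  have [a [b pE]] := near e1; apply: (affine a b) => s hs.
  have sc := le_trans (le_len s hs) hc.
  have [[sy _]|[r sE [r0 _]]] := in_segP hs; first by move: sc; rewrite sy.
  by exists r => //; apply: pE; [exact: addr_ge0|rewrite -lee_fin EFinD -sE].
have mid : (forall l : R, len e1 = l%:E -> (len e + c%:E <= (l - delta)%:E)%E) ->
    real_linear_on_edge e g.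
  move=> hl; have [b pE] := middle e1; exists 0, b; split=> // s hs.
  rewrite mul0r add0r E // gE ?cin // pE ?cin //; last first.
    by move=> l /hl; exact/le_trans/le_len.
  have s0 : (0 <= s)%E by move: hs; rewrite in_itv => /andP[].
  by rewrite -[delta%:E]add0e leeD // lee_fin.
have [El1|[l El1 l0]] := len_fin_or_infty e1.
  by apply: mid => l; rewrite El1.
have [hc2|hc2] := refined_edge_avoids E (v2 l El1); last first.
  by apply: mid => l'; rewrite El1 => -[<-].
have [a [b pE]] := far e1 l El1; apply: (affine a b) => s hs.
have := cin s hs; rewrite El1.
have [[sy _]|[r sE [r0 _]]] := in_segP hs; first by rewrite sy addye // in_itv /= leye_eq andbF.
rewrite sE -EFinD in_segE lee_fin => /andP[_ rl]; exists r => //.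
by apply: pE => //; lra.
Qed.

Lemma vbump_linear (u : vertex M) (e : edge N) : real_linear_on_edge e (vbump delta u).
Proof.
apply: (collar_edge (p := vbump_edge delta u)); first by move=> *; exact: vbump_ept.
- move=> {}e; exists (if ends e false == u then -1 else 0).
  exists (if ends e false == u then delta else 0).
  move=> r r0 rd; rewrite /vbump_edge.
  have -> : (if len e is l%:E then if ends e true == u then Num.max 0 (delta - (l - r)) else 0
     else 0) = 0.
    have := dP e; case: (len e) => [l| |] //; rewrite lee_fin => dl.
    by case: ifP => // _; rewrite max_l //; lra.
  case: ifP => _; last by rewrite maxxx mul0r addr0.
  have h : 0 <= delta - r by lra.
  by rewrite mulN1r (max_r h) (max_l h) addrC.
- move=> {}e l El; have := dP e; rewrite El lee_fin => dl.
  exists (if ends e true == u then 1 else 0), (if ends e true == u then delta - l else 0).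
  move=> r rd rl; rewrite /vbump_edge El (max_l (y := delta - r)); last by lra.
  rewrite if_same; case: ifP => _; last by rewrite maxxx mul0r addr0.
  have h : 0 <= delta - (l - r) by lra.
  by rewrite mul1r !(max_r h); ring.
- move=> {}e; exists 0 => s hs; have [[-> _]|[r -> _]] := in_segP hs; first by [].
  rewrite lee_fin => dr rl; rewrite /vbump_edge (max_l (y := delta - r)); last by lra.
  rewrite if_same max_l //; case El : (len e) => [l| |] //; case: ifP => // _.
  by have := rl l El; rewrite lee_fin => ?; rewrite max_l //; lra.
Qed.

Lemma ebump_linear (e0 : edge M) (e : edge N) : real_linear_on_edge e (ebump delta e0).
Proof.
apply: (collar_edge (p := ebump_edge delta e0)); first by move=> *; exact: ebump_ept.
- move=> {}e; exists (if e == e0 then 1 else 0), 0 => r r0 rd; rewrite /ebump_edge.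
  case: ifP => _; last by rewrite mul0r addr0.
  have := dP e; rewrite /edge_tent; case: (len e) => [l| |] //=.
    by rewrite lee_fin => dl; rewrite mul1r addr0 (min_l (x := r)) ?min_r //; lra.
  by move=> _; rewrite mul1r addr0 min_r.
- move=> {}e l El; exists (if e == e0 then -1 else 0), (if e == e0 then l else 0) => r rd rl.
  have := dP e; rewrite El lee_fin => dl.
  rewrite /ebump_edge; case: ifP => _; last by rewrite mul0r addr0.
  by rewrite /edge_tent El /= mulN1r (min_r (x := r)) ?min_r //; lra.
- move=> {}e; exists (if e == e0 then delta else 0) => s hs; have [[-> _]|[r -> _]] := in_segP hs.
    by [].
  rewrite lee_fin => dr rl; rewrite /ebump_edge; case: ifP => // _; rewrite min_l //.
  rewrite /edge_tent; case El : (len e) => [l| |] //=; have := rl l El; rewrite lee_fin => rld.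
  by rewrite le_min dr; lra.
Qed.

End BumpLinear.

Section SeparatingFunctions.
Context {R : realType} {X : topologicalType} {d : X -> X -> \bar R}.
Context {K : finGroupType} {to : {action K &-> X}}.
Variables (hK : isometric_action d to) (M N : model d).
Hypotheses (hVM : vertex_invariant (to := to) M) (hVN : vertex_invariant (to := to) N).
Hypothesis slopeN : forall e : edge N, exists (a : int) (b : R), (a = 1 \/ a = -1) /\
  forall s : \bar R, s \in `[0%E, len e] -> opp_vdist M (ept e s) = ((a%:~R : R)%:E * s + b%:E)%E.
Variable delta : R.
Hypotheses (d0 : 0 < delta) (dP : forall e : edge N, ((delta *+ 2)%:E <= len e)%E).

Definition average (g : X -> R) (x : X) : R := \sum_(k : K) g (to x k).

Lemma average_act g x k : average g (to x k) = average g x.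
Proof.
rewrite /average [RHS](reindex_inj (mulgI k)) /=.
by apply: eq_bigr => k' _; rewrite to_mul.
Qed.

Lemma average_gt0 g x : (forall y, 0 <= g y) -> 0 < average g x <-> exists k, 0 < g (to x k).
Proof.
move=> g0; split=> [|[k gk]].
  rewrite lt0r psumr_eq0 // => /andP[/allPn[k _ gk] _]; exists k.
  by rewrite lt0r gk g0.
rewrite /average (bigD1 k) //=; apply: ltr_pwDl => //.
by apply: sumr_ge0.
Qed.

Definition sep_index := option (option (vertex N + edge N)).

(* [opp_vdist M] has slope [1] or [-1] along every edge of [N], so it locates a point
   on its edge; the averaged bumps tell in which orbit that edge or vertex lies. *)
Definition sep_fun (i : sep_index) (x : X) : \bar R :=
  match i with
  | None => 0%E
  | Some None => opp_vdist M x
  | Some (Some (inl v)) => (average (vbump delta v) x)%:E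
  | Some (Some (inr e)) => (average (ebump delta e) x)%:E
  end.

Lemma sep_fun_act i k x : sep_fun i (to x k) = sep_fun i x.
Proof.
case: i => [[[v|e]|]|] //=; rewrite ?average_act //.
exact: (opp_vdist_act hK hVM).
Qed.

Lemma sep_fun_ny i x : sep_fun i x <> +oo%E.
Proof. by case: i => [[[v|e]|]|] //=; exact: opp_vdist_ny. Qed.

Lemma opp_vdist_inj (e : edge N) (s t : \bar R) : s \in `[0%E, len e] -> t \in `[0%E, len e] ->
  opp_vdist M (ept e s) = opp_vdist M (ept e t) -> s = t.
Proof.
move=> hs ht; have [a [b [a1 E]]] := slopeN e.
by rewrite !E //; exact: affine_inj.
Qed.

(** Equal averages of the bump on [e] bring a translate of [y] onto [e]; there [opp_vdist M], being
    invariant and injective, forces the same parameter. *)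
Lemma sep_edge (e : edge N) (s : \bar R) y : s \in `[0%E, len e] -> 0 < ebump delta e (ept e s) ->
  (forall i, sep_fun i (ept e s) = sep_fun i y) -> exists k, to y k = ept e s.
Proof.
move=> hs b0 E; have ge0 := ebump_ge0 d0 e.
have : 0 < average (ebump delta e) (ept e s).
  by apply/average_gt0 => //; exists 1%g; rewrite to_one.
have := E (Some (Some (inr e))) => -[->] /(average_gt0 _ ge0)[k].
move=> /(ebump_supp d0)[t ht yt]; exists k; rewrite yt; congr ept.
apply: (opp_vdist_inj (e := e)) => //; rewrite -yt (opp_vdist_act hK hVM).
exact: (esym (E (Some None))).
Qed.

(** Edge bumps detect interior points and leaves at infinity. The vertices left over are those whose
    own bump is positive, by [vbump_vpt_self]. *)
Lemma edge_bump_cases (x : X) :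
  (exists (e : edge N) (s : \bar R), [/\ s \in `[0%E, len e], x = ept e s
      & 0 < ebump delta e (ept e s)]) \/
  exists2 v : vertex N, x = vpt v & forall e : edge N, len e = +oo%E -> ends e true <> v.
Proof.
have [[v ->]|[e [s [hs ->]]]] := model_cover N x; last first.
  left; exists e, s; split=> //; first exact: open_closed.
  by apply: ebump_gt0 => //; left.
have [[e [El <-]]|H] := pselect (exists e : edge N, len e = +oo%E /\ ends e true = v).
  left; exists e, +oo%E; split; first by rewrite El in_itv /= lexx leey.
    by rewrite -ept_len El.
  by apply: ebump_gt0 => //; right.
by right; exists v => // e El E; apply: H; exists e.
Qed.

(** Because elements of [K] are invertible, it is enough that one of the two points is detected by
    an edge bump. If both are vertices left over, equal averages of the bump at the first bring a
    translate of the second onto it. *)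
Lemma sep_fun_sep x y : (forall i, sep_fun i x = sep_fun i y) -> exists k, to x k = y.
Proof.
move=> E; have [[e [s [hs yE b0]]]|[w yE _]] := edge_bump_cases y.
  by rewrite yE; apply: sep_edge => // i; rewrite -yE.
suff [k kE] : exists k, to y k = x by exists k^-1%g; rewrite -kE to_invK.
have [[e [s [hs xE b0]]]|[v xE vfin]] := edge_bump_cases x.
  by rewrite xE; apply: sep_edge => // i; rewrite -xE.
have ge0 := vbump_ge0 d0 dP v.
have : 0 < average (vbump delta v) x.
  by apply/average_gt0 => //; exists 1%g; rewrite to_one xE vbump_vpt_self.
have := E (Some (Some (inl v))) => -[->] /(average_gt0 _ ge0)[k].
rewrite yE; have [u uE] := hVN k w; rewrite uE => /vbump_vpt_gt0 uv.
by exists k; rewrite uE uv xE.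
Qed.

Lemma sep_fun_linear (N' : model d) : refines N' N -> vertex_invariant (to := to) N' ->
  (forall e : edge N, is_vertex N' (ept e delta%:E) /\
    forall l : R, len e = l%:E -> is_vertex N' (ept e (l - delta)%:E)) ->
  forall i (e : edge N'), linear_on_edge e (sep_fun i).
Proof.
move=> rN hV' collar [[[v|e0]|]|] e /=.
- apply: real_linear_linear; apply: real_linear_sum => k.
  by apply: (real_linear_act hK hV') => {}e; exact: (vbump_linear d0 dP rN collar).
- apply: real_linear_linear; apply: real_linear_sum => k.
  by apply: (real_linear_act hK hV') => {}e; exact: (ebump_linear d0 dP rN collar).
- have [e1 [c [c0 cl E]]] := rN e; have [a [b [_ E1]]] := slopeN e1.
  by exists a, (a%:~R * c + b); exact: (affine_on_refinement c0 cl E E1).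
- by exists 0, 0 => s _; rewrite mul0e adde0.
Qed.

Lemma sep_fun_slope (N' : model d) : refines N' N ->
  forall e : edge N', exists (a : int) (b : R), (a = 1 \/ a = -1) /\
    forall s : \bar R, s \in `[0%E, len e] ->
      sep_fun (Some None) (ept e s) = ((a%:~R : R)%:E * s + b%:E)%E.
Proof.
move=> rN e; have [e1 [c [c0 cl E]]] := rN e; have [a [b [a1 E1]]] := slopeN e1.
by exists a, (a%:~R * c + b); split=> //; exact: (affine_on_refinement c0 cl E E1).
Qed.

End SeparatingFunctions.

Theorem theorem1p0p1 (R : realType) (X : topologicalType)
    (d : X -> X -> \bar R) (hX : metric_graph d)
    (K : finGroupType) (to : {action K &-> X}) (hK : isometric_action d to) :
  exists n : nat, (0 < n)%N /\
  exists (f : 'I_n -> X -> \bar R) (phi : X -> TP R n),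
    (forall i, rational_function d (f i)) /\
    rational_map d f phi /\
    exists (M : model d) (M' : model (image_dist d f phi))
      (F : mg_morphism M M' (to_image phi))
      (m : edge M -> nat) (m' : edge M' -> nat),
      galois_covering to F m m'.
Proof.
have [M0] := hX.
(* Distances are measured from the vertices of [M1], and [opp_vdist M1] has slope 1 or -1 on the
   edges of [N]. The bumps are formed on [N]; their break points are vertices of [N'], the model on
   which all functions are linear and which carries the covering. *)
have [M1 hV1] := invariant_model (to := to) M0.
have [N [rN hVN mid]] := midpoint_model hK hV1.
have [delta d0 dP] := half_min_len N.
have [N' [rN' hVN' collar]] := collar_model hK hVN d0 dP.
have slopeN := opp_vdist_slope rN mid.
pose g := sep_fun (to := to) M1 (N := N) delta.
pose f (i : 'I_#|{: sep_index N}|) := g (enum_val i).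
pose i0 := enum_rank (None : sep_index N).
pose i1 := enum_rank (Some None : sep_index N).
have f0 x : f i0 x = 0%E by rewrite /f enum_rankK.
have flin i (e : edge N') : linear_on_edge e (f i) by exact: sep_fun_linear.
have fny i x : f i x <> +oo%E by exact: sep_fun_ny.
have finv i k x : f i (to x k) = f i x by exact: sep_fun_act.
have fsep x y : (forall i, f i x = f i y) -> exists k, to x k = y.
  move=> E; apply: (sep_fun_sep hK hV1 hVN slopeN d0 dP) => i.
  by have := E (enum_rank i); rewrite /f enum_rankK.
have fslope (e : edge N') : exists (a : int) (b : R), (a = 1 \/ a = -1) /\
    forall s : \bar R, s \in `[0%E, len e] -> f i1 (ept e s) = ((a%:~R : R)%:E * s + b%:E)%E.
  by rewrite /f enum_rankK; exact: sep_fun_slope.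
exists #|{: sep_index N}|; split; first by apply/card_gt0P; exists None.
exists f, (phi f0 fny); split; first by move=> i; right; exists N' => e; exact: flin.
split; first by split; [exact: phi_continuous|move=> x _; exact: trop_coords_phi].
exact: (ex_intro _ N' (galois_covering_phi hK hVN' f0 flin fny finv fsep fslope)).
Qed.
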